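(* Let $G=(V,E)$ be an aperiodic, in-degree regular, transitive, finite directed graph, with in-degree $d$. Then there exist Cuntz isometries $W_1,\dots,W_d$ on a (nonzero) Hilbert space $\mathcal{H}$, whose generated WOT-closed algebra is $B(\mathcal{H})$, and a strong edge colouring $c:E\to\{1,\dots,d\}$ of $G$, such that the free semigroupoid algebra $\mathfrak{S}_c$ of the CK family $\mathrm{S}_c$ associated with $c$ and $W_1,\dots,W_d$ is $B(\mathcal{K})$, where $\mathcal{K}=\bigoplus_{v\in V}\mathcal{H}_v$ with each $\mathcal{H}_v\cong\mathcal{H}$.
   Context: A directed graph $G=(V,E,s,r)$ has vertex set $V$, edge set $E$ and source and range maps $s,r:E\to V$ (multiple edges and loops allowed); it is finite if $V$ and $E$ are finite. It is transitive if for any $v,w\in V$ there is a directed path from $v$ to $w$. It is in-degree regular with in-degree $d$ if $|r^{-1}(v)|=d$ for every $v\in V$. A transitive graph is aperiodic if for any $v,w\in V$ there is a positive integer $K_0$ such that for every $K\ge K_0$ there is a directed path of length $K$ from $v$ to $w$. A strong edge colouring of $G$ with $d$ colours is a function $c:E\to\{1,\dots,d\}$ such that, for every vertex $v$, distinct edges with range $v$ have different colours. Cuntz isometries $W_1,\dots,W_d$ on $\mathcal{H}$: $W_i^*W_i=I$ for all $i$ and $\sum_{i=1}^dW_iW_i^*=I$. Given these, let $\mathcal{K}=\bigoplus_{v\in V}\mathcal{H}_v$ with $\mathcal{H}_v\cong\mathcal{H}$ via a fixed unitary $J_v:\mathcal{H}_v\to\mathcal{H}$, regarded as a partial isometry $\mathcal{K}\to\mathcal{H}$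 vanishing on $\mathcal{H}_v^\perp$. Put $S_v=P_{\mathcal{H}_v}$ for $v\in V$, and $S_e=J_{r(e)}^*W_{c(e)}J_{s(e)}$ for $e\in E$. Then $\mathrm{S}_c=(S_v,S_e)$ is a CK family, i.e. the $S_v$ are pairwise orthogonal projections, $S_e^*S_e=S_{s(e)}$, and $\sum_{r(e)=v}S_eS_e^*=S_v$ for all $v$. $\mathfrak{S}_c$ is the WOT-closed algebra generated by $\{S_v,S_e\}$. *)

(* Defs.v *)
From HB Require Import structures.
From mathcomp Require Import all_boot all_order all_algebra.
From mathcomp Require Import sesquilinear complex ring.
From mathcomp Require Import all_classical all_reals all_analysis.

Set Implicit Arguments.
Unset Strict Implicit.
Unset Printing Implicit Defensive.

Import Order.TTheory GRing.Theory Num.Theory.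
Import numFieldNormedType.Exports.

Local Open Scope classical_set_scope.
Local Open Scope ring_scope.

Section DotNorm.
Variables (C : numClosedFieldType) (U : lmodType C).
Variable form : {dot U for (@Num.conj C)}.

Let dnorm (x : U) : C := sqrtC (form x x).

Lemma dnormZ_sqrt (a : C) (x : U) : dnorm (a *: x) = `|a| * dnorm x.
Proof. by rewrite /dnorm dnormZ sqrtCM ?nnegrE ?exprn_ge0// sqrCK. Qed.

Lemma dnorm_eq0_sqrt (x : U) : dnorm x = 0 -> x = 0.
Proof. by move/eqP; rewrite sqrtC_eq0 dnorm_eq0 => /eqP. Qed.

Lemma dot_CauchySchwarz (x y : U) :
  `|form x y| ^+ 2 <= form x x * form y y.
Proof.
have [->|y0] := eqVneq y 0; first by rewrite !linear0 normr0 mulr0 expr0n.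
have yy : 0 < form y y by rewrite dnorm_gt0.
have yyr : (form y y)^* = form y y by apply/CrealP; rewrite ger0_real ?ltW.
have E a b : form (a *: x) (b *: y) = a * (b^* * form x y).
  by rewrite linearZl_LR linearZr_LR.
have := dnorm_ge0 form (form y y *: x - form x y *: y).
rewrite dnormB !dnormZ E (ger0_norm (ltW yy)) normCK !rmorphM/= conjCK yyr.
set p := form x y; set D := form y y.
rewrite [X in 0 <= X -> _](_ : _ = D * (form x x * D - p * p^*)); last by ring.
by rewrite pmulr_rge0// subr_ge0.
Qed.

Lemma dnormD_sqrt (x y : U) : dnorm (x + y) <= dnorm x + dnorm y.
Proof.
rewrite -ler_sqr ?nnegrE ?addr_ge0 ?sqrtC_ge0 ?dnorm_ge0//.
rewrite sqrrD !sqrtCK dnormD addrAC lerD2r lerD2l.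
have [+ _] := leif_Re_Creal (form x y).
rewrite ReE ler_pdivrMr// mulr_natr => /le_trans; apply.
rewrite lerMn2r/= -ler_sqr ?nnegrE ?mulr_ge0 ?sqrtC_ge0 ?dnorm_ge0//.
by rewrite exprMn !sqrtCK dot_CauchySchwarz.
Qed.

End DotNorm.

(* The inner product is linear in its first argument. *)

HB.mixin Record isInnerProduct (R : realType) T & NormedModule R[i] T := {
  inner : {dot T for (@Num.conj R[i])};
  sqr_normE : forall x : T, `|x| ^+ 2 = inner x x
}.

#[short(type="preHilbertType")]
HB.structure Definition PreHilbert (R : realType) :=
  {T of NormedModule R[i] T & isInnerProduct R T}.

#[short(type="hilbertType")]
HB.structure Definition Hilbert (R : realType) :=
  {T of PreHilbert R T & CompleteNormedModule R[i] T}.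

Notation "''[' x , y ]" := (inner x y) : ring_scope.

HB.factory Record Lmodule_isPreHilbert (R : realType) T & GRing.Lmodule R[i] T := {
  dot : {dot T for (@Num.conj R[i])}
}.

HB.builders Context R T & Lmodule_isPreHilbert R T.

HB.instance Definition _ := Lmodule_isNormed.Build R[i] T
  (dnormD_sqrt dot) (dnormZ_sqrt dot) (@dnorm_eq0_sqrt _ _ dot).

Let sqr_norm (x : T) : `|x| ^+ 2 = dot x x.
Proof. by rewrite sqrtCK. Qed.

HB.instance Definition _ := isInnerProduct.Build R T sqr_norm.

HB.end.
(* The direct sum of copies of H indexed by V, with its l^2 norm. *)
Definition hsum (R : realType) (V : finType) (H : hilbertType R) : Type :=
  {ffun V -> H}.

Section HilbertSum.
Variables (R : realType) (V : finType) (H : hilbertType R).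
Local Notation K := (hsum V H).

HB.instance Definition _ := GRing.Lmodule.on K.

Definition hsum_dot (x y : K) : R[i] := \sum_v '[x v, y v].

Let hsum_dotl (y : K) : linear_for *%R (hsum_dot ^~ y).
Proof.
move=> a x x'; rewrite /hsum_dot mulr_sumr -big_split; apply: eq_bigr => v _.
by rewrite !ffunE linearPl.
Qed.

Let hsum_dotr (x : K) : linear_for (@Num.conj R[i] \; *%R) (hsum_dot x).
Proof.
move=> a y y'; rewrite /hsum_dot/= mulr_sumr -big_split; apply: eq_bigr => v _.
by rewrite !ffunE linearPr.
Qed.

HB.instance Definition _ := bilinear_isBilinear.Build R[i] K K R[i] _ _ hsum_dot
  (hsum_dotl, hsum_dotr).

Let hsum_dotC (x y : K) : hsum_dot x y = (-1) ^+ false * (hsum_dot y x)^*.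
Proof.
rewrite expr0 mul1r rmorph_sum; apply: eq_bigr => v _.
by rewrite hermC expr0 mul1r.
Qed.

HB.instance Definition _ :=
  isHermitianSesquilinear.Build R[i] K false (@Num.conj R[i]) hsum_dot hsum_dotC.

Let hsum_dot_gt0 (x : K) : x != 0 -> 0 < hsum_dot x x.
Proof.
move=> /eqP x0; rewrite lt_def sumr_ge0 => [|v _]; last exact: dnorm_ge0.
rewrite andbT psumr_eq0 => [|v _]; last exact: dnorm_ge0.
apply: contra_notN x0 => /allP xv; apply/ffunP => v; rewrite ffunE.
by apply/eqP; rewrite -(dnorm_eq0 inner); exact: xv (mem_index_enum v).
Qed.

HB.instance Definition _ := isDotProduct.Build R[i] K hsum_dot hsum_dot_gt0.

HB.instance Definition _ := Lmodule_isPreHilbert.Build R K hsum_dot.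

Lemma hsum_innerE (x y : K) : '[x, y] = \sum_v '[x v, y v].
Proof. by []. Qed.

Lemma hsum_norm_le (x : K) : `|x| <= \sum_v `|x v|.
Proof.
rewrite -ler_sqr ?nnegrE ?sumr_ge0// sqr_normE hsum_innerE.
under eq_bigr do rewrite -sqr_normE.
rewrite expr2 mulr_suml; apply: ler_sum => v _.
by rewrite expr2 ler_wpM2l// (bigD1 v)//= lerDl sumr_ge0.
Qed.

Lemma hsum_coord_le (x : K) v : `|x v| <= `|x|.
Proof.
rewrite -ler_sqr ?nnegrE// !sqr_normE hsum_innerE (bigD1 v)//= lerDl.
by apply: sumr_ge0 => w _; exact: dnorm_ge0.
Qed.

Let hsum_complete (F : set_system K) : ProperFilter F -> cauchy F -> cvg F.
Proof.
move=> FF /cauchy_ballP Fc.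
have Fvc v : cvg ((fun x : K => x v) @ F).
  apply/cauchy_cvgP/cauchy_ballP => e e0.
  pose ev (x : K) := x v.
  rewrite (@near_map2 K K H H ev ev F F).
  have := Fc _ e0; apply: filterS => -[x y] /=.
  rewrite -!ball_normE/=; apply: le_lt_trans.
  by rewrite (_ : x v - y v = (x - y) v) ?hsum_coord_le// !ffunE.
apply/cvg_ex; exists [ffun v => lim ((fun x : K => x v) @ F)].
apply/cvgrPdist_lt => e e0.
have d0 : 0 < e / #|V|.+1%:R by rewrite divr_gt0.
have : F [set x : K | forall v,
    `|lim ((fun z : K => z v) @ F) - x v| < e / #|V|.+1%:R].
  apply: filter_forall => v.
  by have /cvgrPdist_lt/(_ _ d0) := Fvc v.
apply: filterS => x xv.
apply: le_lt_trans (hsum_norm_le _) _.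
apply: (@le_lt_trans _ _ (\sum_(v : V) e / #|V|.+1%:R)).
  by apply: ler_sum => v _; rewrite !ffunE ltW.
rewrite sumr_const -(mulr_natr (e / _)) -mulrA -[ltRHS]mulr1 ltr_pM2l//.
by rewrite mulrC ltr_pdivrMr// mul1r ltr_nat.
Qed.

HB.instance Definition _ := Uniform_isComplete.Build K hsum_complete.
End HilbertSum.

Definition bounded_linear (R : realType) (H K : hilbertType R) : {pred H -> K} :=
  mem [set f : H -> K | linear f /\ exists M, forall x, `|f x| <= M * `|x|].
Arguments bounded_linear {R} H K.

Record boundedOp (R : realType) (H K : hilbertType R) := BoundedOp {
  op_fun :> H -> K;
  op_bounded_linear : op_fun \in bounded_linear H K
}.

Notation "''B' ( H , K )" := (boundedOp H K)
  (at level 8, H at level 99, K at level 99, format "''B' ( H ,  K )") : type_scope.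
Notation "''B' ( H )" := 'B(H, H) (only parsing) : type_scope.

Section BoundedOps.
Variable R : realType.
Implicit Types H K L : hilbertType R.

HB.instance Definition _ H K := [isSub for @op_fun R H K].
HB.instance Definition _ H K := [Choice of 'B(H, K) by <:].

Let bounded_linear_closed H K : submod_closed (bounded_linear H K).
Proof.
split=> [|a f g].
  apply/mem_set; split=> [b x y|]; first by rewrite scaler0 addr0.
  by exists 0 => x; rewrite mul0r normr0.
move=> /set_mem[fl [M fM]] /set_mem[gl [N gN]]; apply/mem_set; split=> [b x y|].
  rewrite /= !fctE fl gl !scalerDr !scalerA addrACA; congr (_ + _).
  by rewrite mulrC.
exists (`|a| * M + N) => x; rewrite mulrDl -mulrA.
rewrite (le_trans (ler_normD _ _))// lerD// normrZ.
by rewrite ler_wpM2l.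
Qed.

HB.instance Definition _ H K :=
  GRing.isSubmodClosed.Build R[i] (H -> K) (bounded_linear H K)
    (bounded_linear_closed H K).
HB.instance Definition _ H K :=
  [SubChoice_isSubLmodule of 'B(H, K) by <:].

Lemma boundedOpP H K (T : 'B(H, K)) :
  linear T /\ exists M, forall x, `|T x| <= M * `|x|.
Proof. exact: set_mem (op_bounded_linear T). Qed.

HB.instance Definition _ H K (T : 'B(H, K)) :=
  GRing.isLinear.Build R[i] H K *:%R T (boundedOpP T).1.

Lemma boundedOp_ext H K (S T : 'B(H, K)) : S =1 T -> S = T.
Proof. by move=> ST; apply/val_inj/funext. Qed.

Fact id_op_subproof H : (@idfun H : H -> H) \in bounded_linear H H.
Proof. by apply/mem_set; split=> //; exists 1 => x; rewrite mul1r. Qed.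

Definition id_op H : 'B(H) := BoundedOp (id_op_subproof H).

Fact comp_op_subproof H K L (S : 'B(K, L)) (T : 'B(H, K)) :
  S \o T \in bounded_linear H L.
Proof.
apply/mem_set; split=> [a x y|]; first by rewrite /= !linearP.
have [[_ [M SM]] [_ [N TN]]] := (boundedOpP S, boundedOpP T).
exists (`|M| * N) => x; rewrite -mulrA; apply: le_trans (SM _) _.
have N0 : 0 <= N * `|x| by exact: le_trans (TN x).
have [y0|y0] := eqVneq (T x) 0; first by rewrite /= y0 normr0 mulr0 mulr_ge0.
have M0 : 0 <= M.
  by rewrite -(pmulr_lge0 _ (_ : 0 < `|T x|)) ?normr_gt0// (le_trans _ (SM _)).
by rewrite (ger0_norm M0) ler_wpM2l.
Qed.

Definition comp_op H K L (S : 'B(K, L)) (T : 'B(H, K)) : 'B(H, L) :=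
  BoundedOp (comp_op_subproof S T).

(* The adjoint: by the Riesz representation theorem there is exactly one
   operator with the defining property, so that the default 0 never occurs. *)
Definition adj H K (T : 'B(H, K)) : 'B(K, H) :=
  xget 0 [set S : 'B(K, H) | forall x y, '[T x, y] = '[x, S y]].

Lemma adjP H K (T : 'B(H, K)) (S : 'B(K, H)) :
  (forall x y, '[T x, y] = '[x, S y]) -> adj T = S.
Proof.
move=> TS; rewrite /adj; case: xgetP => [S' _ TS'|/(_ S)//].
apply/boundedOp_ext => y; apply/eqP; rewrite -subr_eq0 -(dnorm_eq0 inner).
by rewrite linearBr/= -!TS' -!TS subrr.
Qed.

End BoundedOps.

Notation "S \ob T" := (comp_op S T)
  (at level 50, left associativity, format "S  \ob  T") : ring_scope.

Section OperatorAlgebras.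
Variables (R : realType) (H : hilbertType R).

Definition matrix_coefs (T : 'B(H)) : {ptws H * H -> R[i]^o} :=
  fun p => '[T p.1, p.2].

(* The coarsest topology on B(H) for which every T |-> '[T x, y] is
   continuous. *)
Definition wot : Type := initial_topology matrix_coefs.

HB.instance Definition _ :=
  Topological.copy wot (initial_topology matrix_coefs).

Definition wot_closed (A : set 'B(H)) := closed (A : set wot).

Definition subalgebra (A : set 'B(H)) :=
  [/\ A 0,
      forall (a : R[i]) S T, A S -> A T -> A (a *: S + T)
    & forall S T, A S -> A T -> A (S \ob T)].

(* Subalgebras are not required to contain the identity. *)
Definition wot_algebra (G : set 'B(H)) : set 'B(H) :=
  smallest [set A | subalgebra A /\ wot_closed A] G.

End OperatorAlgebras.

Definition cuntz_isometries (R : realType) (H : hilbertType R) (d : nat)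
    (W : 'I_d -> 'B(H)) :=
  (forall i, adj (W i) \ob W i = id_op H) /\
  \sum_(i < d) (W i \ob adj (W i)) = id_op H.

Section Coordinates.
Variables (R : realType) (V : finType) (H : hilbertType R).
Local Notation K := (hsum V H).

Fact coord_op_subproof v : (fun x : K => x v) \in bounded_linear K H.
Proof.
apply/mem_set; split=> [a x y|]; first by rewrite !ffunE.
by exists 1 => x; rewrite mul1r hsum_coord_le.
Qed.

(* The partial isometry J_v from the direct sum to H. *)
Definition coord_op v : 'B(K, H) := BoundedOp (coord_op_subproof v).

Fact proj_op_subproof v :
  (fun x : K => [ffun w => if w == v then x w else 0] : K) \in bounded_linear K K.
Proof.
apply/mem_set; split=> [a x y|].
  by apply/ffunP => w; rewrite !ffunE; case: eqP; rewrite ?scaler0 ?addr0.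
exists 1 => x; rewrite mul1r -ler_sqr ?nnegrE// !sqr_normE !hsum_innerE.
apply: ler_sum => w _; rewrite ffunE; case: eqP => // _.
by rewrite linear0 dnorm_ge0.
Qed.

(* The orthogonal projection onto the v-th summand. *)
Definition proj_op v : 'B(K) := BoundedOp (proj_op_subproof v).

Fact incl_op_subproof v :
  (fun y : H => [ffun w => if w == v then y else 0] : K) \in bounded_linear H K.
Proof.
apply/mem_set; split=> [a x y|].
  by apply/ffunP => w; rewrite !ffunE; case: eqP; rewrite ?scaler0 ?addr0.
exists 1 => y; rewrite mul1r -ler_sqr ?nnegrE// !sqr_normE !hsum_innerE.
rewrite (bigD1 v)//= big1 => [|w wv]; first by rewrite ffunE eqxx addr0.
by rewrite ffunE (negbTE wv) linear0.
Qed.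

Lemma adj_coord_op v : adj (coord_op v) = BoundedOp (incl_op_subproof v).
Proof.
apply: adjP => x y /=; rewrite hsum_innerE (bigD1 v)//= big1 => [|w wv].
  by rewrite ffunE eqxx addr0.
by rewrite ffunE (negbTE wv) linear0.
Qed.

End Coordinates.

Record digraph := Digraph {
  vertex : finType;
  edge : finType;
  src : edge -> vertex;
  rng : edge -> vertex
}.

Section Digraphs.
Variable G : digraph.

Fixpoint dipath (v : vertex G) (p : seq (edge G)) (w : vertex G) : bool :=
  if p is e :: q then (src e == v) && dipath (rng e) q w else v == w.

Definition transitive_graph :=
  forall v w : vertex G, exists p, dipath v p w.

Definition in_degree_regular (d : nat) :=
  forall v : vertex G, #|[pred e : edge G | rng e == v]| = d.

Definition aperiodic :=
  forall v w : vertex G, exists2 K0 : nat, (0 < K0)%N &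
    forall k : nat, (K0 <= k)%N -> exists2 p, size p = k & dipath v p w.

Definition strong_edge_colouring (d : nat) (c : edge G -> 'I_d) :=
  forall e f : edge G, rng e = rng f -> e != f -> c e != c f.

End Digraphs.

Section ColouredFamily.
Variables (R : realType) (G : digraph) (H : hilbertType R) (d : nat).
Variables (W : 'I_d -> 'B(H)) (c : edge G -> 'I_d).
Local Notation K := (hsum (vertex G) H).

Definition CK_vertex (v : vertex G) : 'B(K) := proj_op H v.

Definition CK_edge (e : edge G) : 'B(K) :=
  adj (coord_op H (rng e)) \ob W (c e) \ob coord_op H (src e).

Definition free_semigroupoid_algebra : set 'B(K) :=
  wot_algebra (range CK_vertex `|` range CK_edge).

End ColouredFamily.

(* Main.v *)
(* For d >= 2 let H = l^2(nat), with the permutative isometries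
   P_i e_j = e_(d j + i), and for a unit vector f put W_i = (1 - u u^* ) P_i with
   u = P_1 f - e_0, so that W_1 f = e_0. A finitely supported vector is consumed
   by the W_i^* as if by the P_i^*, except that each arrival at e_0 followed by
   the letter 1 restarts the process at f.

   The vector f = sum_k a_k sum_(|v| = K) e_(node k v) is supported on the
   numbers node k v whose base d digits, least significant first, are a long run
   of zeros, an arbitrary word v of length K and a target b_k. Split f at stage k
   into a finitely supported part F and a tail g. The weight of any finitely
   supported x that has not yet entered g decays geometrically in the number of
   letters, at a rate depending on F only through its support and mass; so if the
   run of zeros in block k is long enough, almost all of e_0 has entered g before
   the run is read. Let any two vertices be joined by a path of length K
   (aperiodicity). Whatever state of the coloured graph is reached on entering g,
   after the run of zeros a suitable v leads to a prescribed final state. Hence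
   weighted sums of the words (entry into g)(zeros)(v) give elements of every
   corner (s, t) of the algebra that tend weakly, along the k with b_k = b, to
   the rank one operator from e_b to e_0. Multiplying by the W_i on both sides
   yields all rank one operators in every corner, for every strong colouring. For d = 1 the graph is a single loop
   and H is the complex line. *)

From HB Require Import structures.
Require Import Defs.
From mathcomp Require Import all_boot all_order all_algebra.
From mathcomp Require Import sesquilinear complex ring lra.
From mathcomp Require Import all_classical all_reals all_analysis.

Set Implicit Arguments.
Unset Strict Implicit.
Unset Printing Implicit Defensive.

Import Order.TTheory GRing.Theory Num.Theory.
Import numFieldNormedType.Exports.

Local Open Scope classical_set_scope.
Local Open Scope ring_scope.
Local Open Scope complex_scope.

Local Notation Re := (@complex.Re _).
Local Notation Im := (@complex.Im _).

(** * Complex numbers and square-summable sequences *)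

Section Complex.
Variable R : realType.
Implicit Types z w : R[i].

Definition sqmod z : R := Re z ^+ 2 + Im z ^+ 2.

Lemma sqr_normC z : `|z| ^+ 2 = (sqmod z)%:C.
Proof. by rewrite /sqmod add_Re2_Im2. Qed.

Lemma mul_conjC z : z * (Num.conj z) = (sqmod z)%:C.
Proof. by rewrite -normCK sqr_normC. Qed.

Lemma sqmod_ge0 z : 0 <= sqmod z.
Proof. by rewrite addr_ge0 ?sqr_ge0. Qed.

Lemma sqmod_conj z : sqmod (Num.conj z) = sqmod z.
Proof. by apply: complexI; rewrite -!sqr_normC norm_conjC. Qed.

Lemma sqmodM z w : sqmod (z * w) = sqmod z * sqmod w.
Proof. by apply: complexI; rewrite rmorphM/= -!sqr_normC normrM exprMn. Qed.

Lemma sqmodD z w : sqmod (z + w) <= 2 * sqmod z + 2 * sqmod w.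
Proof.
case: z w => [a b] [c e]; rewrite /sqmod/=.
have := sqr_ge0 (a - c); have := sqr_ge0 (b - e); nra.
Qed.

Lemma sqmod_eq0 z : (sqmod z == 0) = (z == 0).
Proof. by rewrite -(inj_eq (@complexI _)) -sqr_normC sqrf_eq0 normr_eq0. Qed.

Lemma normc_le_ReIm z : `|z| <= (`|Re z| + `|Im z|)%:C.
Proof.
rewrite {1}[z]complexE (le_trans (ler_normD _ _))// rmorphD/=.
rewrite normrM !normc_def/= !expr0n !expr1n/= !addr0 !add0r sqrtr1 mul1r.
by rewrite !sqrtr_sqr.
Qed.

Lemma posC e : 0 < e :> R[i] -> e = (Re e)%:C /\ 0 < Re e.
Proof.
by case: e => a b; rewrite ltcE/= => /andP[/eqP->]; rewrite complexr0.
Qed.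

Lemma cvg_complex (T : Type) (F : set_system T) (FF : Filter F)
    (u : T -> R[i]^o) (l : R[i]^o) :
  (fun t => Re (u t)) @ F --> (Re l : R) -> (fun t => Im (u t)) @ F --> (Im l : R) ->
  u @ F --> l.
Proof.
move=> /cvgrPdist_lt ul1 /cvgrPdist_lt ul2; apply/cvgrPdist_lt => e /posC[-> e0].
have e2 : 0 < Re e / 2 by rewrite divr_gt0.
near=> t; rewrite (le_lt_trans (normc_le_ReIm _))// ltcR.
have : `|Re l - Re (u t)| < Re e / 2 by near: t; exact: ul1.
have : `|Im l - Im (u t)| < Re e / 2 by near: t; exact: ul2.
case: (l) (u t) => [a b] [c f]/=; lra.
Unshelve. all: by end_near. Qed.

Lemma cvg_Re (T : Type) (F : set_system T) (FF : Filter F)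
    (u : T -> R[i]^o) (l : R[i]^o) :
  u @ F --> l -> (fun t => Re (u t)) @ F --> (Re l : R).
Proof.
move=> /cvgrPdist_lt ul; apply/cvgrPdist_lt => e e0.
have := ul e%:C; rewrite ltcR => /(_ e0); apply: filterS => t.
move=> h; rewrite -ltcR (le_lt_trans _ h)//.
by have := normc_ge_Re (l - u t); rewrite raddfB.
Qed.

Lemma normc_ge_Im z : `|Im z|%:C <= `|z|.
Proof. by rewrite normc_def lecR -sqrtr_sqr ler_wsqrtr// lerDr sqr_ge0. Qed.

Lemma cvg_Im (T : Type) (F : set_system T) (FF : Filter F)
    (u : T -> R[i]^o) (l : R[i]^o) :
  u @ F --> l -> (fun t => Im (u t)) @ F --> (Im l : R).
Proof.
move=> /cvgrPdist_lt ul; apply/cvgrPdist_lt => e e0.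
have := ul e%:C; rewrite ltcR => /(_ e0); apply: filterS => t.
move=> h; rewrite -ltcR (le_lt_trans _ h)//.
by have := normc_ge_Im (l - u t); rewrite raddfB.
Qed.

Lemma complex_complete (F : set_system R[i]^o) :
  ProperFilter F -> cauchy F -> cvg F.
Proof.
move=> FF /cauchy_ballP Fc.
have aux (p : R[i] -> R) : (forall z w, p (z - w) = p z - p w) ->
    (forall z, `|p z|%:C <= `|z|) -> cvg (p @ F).
  move=> pB ple; apply/cauchy_cvgP/cauchy_ballP => e e0.
  rewrite (@near_map2 _ _ _ _ p p F F).
  have := Fc e%:C; rewrite ltcR => /(_ e0); apply: filterS => -[x y] /=.
  rewrite -!ball_normE/= => h; rewrite -ltcR -pB.
  exact: le_lt_trans (ple _) h.
have /cvg_ex[a Fa] : cvg ((@complex.Re R : R[i] -> R) @ F).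
  by apply: aux => [z w|z]; [rewrite raddfB|exact: normc_ge_Re].
have /cvg_ex[b Fb] : cvg ((@complex.Im R : R[i] -> R) @ F).
  by apply: aux => [z w|z]; [rewrite raddfB|exact: normc_ge_Im].
apply/cvg_ex; exists (a +i* b).
exact: (@cvg_complex _ F _ id (a +i* b)).
Qed.

End Complex.

(** * The complex line as a Hilbert space *)

Definition chilb (R : realType) : Type := R[i]^o.

Section ComplexHilbert.
Variable R : realType.
Local Notation C := (chilb R).

HB.instance Definition _ := NormedModule.copy C R[i]^o.

Definition cdot (x y : C) : R[i] := (x : R[i]) * Num.conj (y : R[i]).

Let cdotl (y : C) : linear_for *%R (cdot ^~ y).
Proof. by move=> a x x'; rewrite /cdot mulrDl -mulrA. Qed.

Let cdotr (x : C) : linear_for (@Num.conj R[i] \; *%R) (cdot x).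
Proof.
by move=> a y y'; rewrite /cdot/= rmorphD rmorphM/= mulrDr mulrCA.
Qed.

HB.instance Definition _ := bilinear_isBilinear.Build R[i] C C R[i] _ _ cdot
  (cdotl, cdotr).

Let cdotC (x y : C) : cdot x y = (-1) ^+ false * Num.conj (cdot y x).
Proof. by rewrite expr0 mul1r /cdot rmorphM/= conjCK mulrC. Qed.

HB.instance Definition _ :=
  isHermitianSesquilinear.Build R[i] C false (@Num.conj R[i]) cdot cdotC.

Let cdot_gt0 (x : C) : x != 0 -> 0 < cdot x x.
Proof. by move=> x0; rewrite /cdot -normCK exprn_gt0// normr_gt0. Qed.

HB.instance Definition _ := isDotProduct.Build R[i] C cdot cdot_gt0.

Let csqr_norm (x : C) : `|x| ^+ 2 = cdot x x.
Proof. exact: normCK. Qed.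

HB.instance Definition _ := isInnerProduct.Build R C csqr_norm.

HB.instance Definition _ := Uniform_isComplete.Build C (@complex_complete R).

End ComplexHilbert.


(** * The sequence space l^2 *)

Section SquareSummable.
Variable R : realType.

Definition square_summable : {pred nat -> R[i]^o} :=
  mem [set u : nat -> R[i]^o |
    exists M : R, forall N, \sum_(n < N) sqmod (u n) <= M].

Lemma square_summable_closed : submod_closed square_summable.
Proof.
split=> [|a u v].
  apply/mem_set; exists 0 => N; rewrite big1// => n _.
  by apply/eqP; rewrite sqmod_eq0.
move=> /set_mem[A uA] /set_mem[B vB]; apply/mem_set.
exists (2 * (sqmod a * A) + 2 * B) => N.
apply: le_trans (_ : \sum_(n < N) (2 * (sqmod a * sqmod (u n)) + 2 * sqmod (v n))
  <= _).
  by apply: ler_sum => n _; rewrite -sqmodM; exact: sqmodD.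
rewrite big_split/= -!mulr_sumr.
have := uA N; have := vB N; have := sqmod_ge0 a; move=> a0 ? ?.
apply: lerD; first by rewrite ler_pM2l// ler_wpM2l.
by rewrite ler_pM2l.
Qed.

HB.instance Definition _ := GRing.isSubmodClosed.Build R[i] (nat -> R[i]^o)
  square_summable square_summable_closed.

Record l2 := L2 { l2_fun :> nat -> R[i]^o; _ : l2_fun \in square_summable }.

HB.instance Definition _ := [isSub for l2_fun].
HB.instance Definition _ := [Choice of l2 by <:].
HB.instance Definition _ := [SubChoice_isSubLmodule of l2 by <:].

Implicit Types x y : l2.

Lemma l2P x : exists M : R, forall N, \sum_(n < N) sqmod (x n) <= M.
Proof. by case: x => u us; exact: set_mem us. Qed.

Lemma l2_ext x y : x =1 y -> x = y.
Proof. by move=> xy; apply/val_inj/funext. Qed.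

Lemma l2D x y n : (x + y) n = x n + y n. Proof. by []. Qed.
Lemma l2N x n : (- x) n = - x n. Proof. by []. Qed.
Lemma l2Z a x n : (a *: x) n = a * x n. Proof. by []. Qed.
Lemma l20 n : (0 : l2) n = 0. Proof. by []. Qed.

Definition l2_psum x y (N : nat) : R[i]^o := \sum_(n < N) x n * Num.conj (y n : R[i]).

Definition l2_dot x y : R[i] := lim (l2_psum x y @ \oo).

(** Since |z w| <= |z|^2 + |w|^2, the real and imaginary parts of the series converge absolutely;
    hence the [lim] in [l2_dot] is a genuine limit. *)
Lemma l2_dot_cvg x y : l2_psum x y @ \oo --> (l2_dot x y : R[i]^o).
Proof.
have [A xA] := l2P x; have [B yB] := l2P y.
have aux (p : R[i] -> R) : (forall z w, p (z + w) = p z + p w) -> p 0 = 0 ->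
    (forall z, `|p z|%:C <= `|z|) ->
    cvg ((fun N => p (l2_psum x y N)) @ \oo).
  move=> pD p0 ple.
  rewrite (_ : (fun _ => _) = series (fun n => p (x n * Num.conj (y n : R[i])))); last first.
    apply/funext => N; rewrite seriesEord/= /l2_psum.
    exact: (big_morph p pD p0).
  apply: normed_cvg; rewrite /=; apply: nondecreasing_is_cvgn.
    by apply: nondecreasing_series => n _ _; exact: normr_ge0.
  exists (A + B) => _ [N _ <-]; rewrite /normed_series_of seriesEord/=.
  apply: le_trans (lerD (xA N) (yB N)); rewrite -big_split; apply: ler_sum => n _ /=.
  rewrite -lecR (le_trans (ple _))// normrM norm_conjC !normc_def -rmorphM lecR.
  rewrite -/(sqmod _) -/(sqmod _).
  have a0 := sqmod_ge0 (x n); have b0 := sqmod_ge0 (y n).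
  have := sqr_sqrtr a0; have := sqr_sqrtr b0.
  move: (Num.sqrt _) (Num.sqrt _) => s t.
  by have := sqr_ge0 (s - t); have := sqr_ge0 (s + t); nra.
have /cvg_ex[a Fa] := aux (@complex.Re R) (raddfD _) (raddf0 _) (@normc_ge_Re R).
have /cvg_ex[b Fb] : cvg ((fun N => Im (l2_psum x y N)) @ \oo).
  by apply: aux => [z w||z]; [rewrite raddfD|rewrite raddf0|exact: normc_ge_Im].
have h : l2_psum x y @ \oo --> (a +i* b : R[i]^o) by exact: cvg_complex.
by rewrite /l2_dot (cvg_lim _ h).
Qed.

End SquareSummable.

Section L2Hilbert.
Variable R : realType.
Local Notation H := (l2 R).
Implicit Types x y : H.

Lemma l2_dot_lim x y (l : R[i]^o) : l2_psum x y @ \oo --> l -> l2_dot x y = l.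
Proof. by move=> h; rewrite /l2_dot (cvg_lim _ h). Qed.

Let dotl y : linear_for *%R (@l2_dot R ^~ y).
Proof.
move=> a x x'; apply: l2_dot_lim.
rewrite (_ : l2_psum _ _ = fun N => a * l2_psum x y N + l2_psum x' y N).
  apply: (@cvgD _ R[i]^o); last exact: l2_dot_cvg.
  apply: cvgM; first exact: cvg_cst.
  exact: l2_dot_cvg.
apply/funext => N; rewrite /l2_psum mulr_sumr -big_split; apply: eq_bigr => n _.
by rewrite l2D l2Z mulrDl mulrA.
Qed.

Lemma cvg_conj (T : Type) (F : set_system T) (FF : Filter F)
    (u : T -> R[i]^o) (l : R[i]^o) :
  u @ F --> l -> (fun t => Num.conj (u t : R[i]) : R[i]^o) @ F --> (Num.conj (l : R[i]) : R[i]^o).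
Proof.
move=> /cvgrPdist_lt ul; apply/cvgrPdist_lt => e /ul; apply: filterS => t.
by rewrite -rmorphB norm_conjC.
Qed.

Let dotC x y : l2_dot x y = (-1) ^+ false * Num.conj (l2_dot y x).
Proof.
rewrite expr0 mul1r; apply: l2_dot_lim.
rewrite (_ : l2_psum _ _ = fun N => Num.conj (l2_psum y x N : R[i]) : R[i]^o).
  by apply: cvg_conj; exact: l2_dot_cvg.
apply/funext => N; rewrite /l2_psum rmorph_sum; apply: eq_bigr => n _.
by rewrite rmorphM/= conjCK mulrC.
Qed.

Let dotr x : linear_for (@Num.conj R[i] \; *%R) (l2_dot x).
Proof.
move=> a y y'; rewrite dotC dotl rmorphD rmorphM/= [in RHS]dotC.
by rewrite [X in _ = _ + X]dotC !expr0 !mul1r.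
Qed.

HB.instance Definition _ := bilinear_isBilinear.Build R[i] H H R[i] _ _ (@l2_dot R)
  (dotl, dotr).

HB.instance Definition _ :=
  isHermitianSesquilinear.Build R[i] H false (@Num.conj R[i]) (@l2_dot R) dotC.

Let psum_sq x N : l2_psum x x N = (\sum_(n < N) sqmod (x n))%:C.
Proof.
by rewrite /l2_psum rmorph_sum; apply: eq_bigr => n _; rewrite mul_conjC.
Qed.

Let dot_sq x : (fun N => \sum_(n < N) sqmod (x n)) @ \oo --> Re (l2_dot x x)
  /\ l2_dot x x = (Re (l2_dot x x))%:C.
Proof.
have h := @l2_dot_cvg R x x.
rewrite (_ : l2_psum x x = fun N => (\sum_(n < N) sqmod (x n))%:C) in h; last first.
  by apply/funext => N; rewrite psum_sq.
split; first exact: (cvg_Re _ h).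
have h0 : cst (0 : R) @ \oo --> Im (l2_dot x x) by exact: (cvg_Im _ h).
have := cvg_lim (@Rhausdorff R) h0; rewrite lim_cst; last exact: Rhausdorff.
by move=> e; rewrite {1}[l2_dot x x]complexE -e rmorph0 mulr0 addr0.
Qed.

Let dot_gt0 x : x != 0 -> 0 < l2_dot x x.
Proof.
move=> x0; have [cv ->] := dot_sq x; rewrite ltcR.
have [n xn] : exists n, x n != 0.
  apply/not_existsP => h; move/eqP: x0; apply; apply/l2_ext => n; rewrite l20.
  by apply/eqP; have /negP := h n; rewrite negbK.
apply: (@lt_le_trans _ _ (sqmod (x n))).
  by rewrite lt_def sqmod_ge0 sqmod_eq0 xn.
apply: (cvgr_to_ge cv); exists n.+1 => // N /= nN.
rewrite (bigD1 (Ordinal nN))//= lerDl sumr_ge0// => i _; exact: sqmod_ge0.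
Qed.

HB.instance Definition _ := isDotProduct.Build R[i] H (@l2_dot R) dot_gt0.

HB.instance Definition _ := Lmodule_isPreHilbert.Build R H (@l2_dot R).

Lemma l2_innerE x y : '[x, y] = l2_dot x y.
Proof. by []. Qed.

Lemma l2_sum_sqr x :
  (fun N => \sum_(n < N) sqmod (x n)) @ \oo --> Re '[x, x].
Proof. by have [] := dot_sq x. Qed.

Lemma l2_partial_le x N : \sum_(n < N) sqmod (x n) <= Re '[x, x].
Proof.
apply: (cvgr_to_ge (@l2_sum_sqr x)); exists N => // M /= NM.
rewrite -!(big_mkord xpredT (fun n => sqmod (x n))) [leRHS](@big_cat_nat _ _ _ N)//=.
by rewrite lerDl sumr_ge0// => i _; exact: sqmod_ge0.
Qed.

Lemma l2_inner_le x (M : R) :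
  (forall N, \sum_(n < N) sqmod (x n) <= M) -> Re '[x, x] <= M.
Proof. by move=> xM; apply: (cvgr_to_le (@l2_sum_sqr x)); exact: nearW. Qed.

Lemma l2_coord_le x n : `|x n| <= `|x|.
Proof.
have [_ e] := dot_sq x.
rewrite -ler_sqr ?nnegrE// sqr_normC sqr_normE l2_innerE e lecR.
apply: le_trans (l2_partial_le x n.+1); rewrite big_ord_recr/= lerDr.
by rewrite sumr_ge0// => i _; exact: sqmod_ge0.
Qed.

Lemma l2_norm_lt x (e : R) : 0 < e -> `|x| < e%:C <-> Re '[x, x] < e ^+ 2.
Proof.
move=> e0; have [_ h] := dot_sq x.
by rewrite -ltr_sqr ?nnegrE ?normr_ge0 ?lecR ?ltW// sqr_normE l2_innerE h -rmorphXn ltcR.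
Qed.

Lemma cvg_sqmod (T : Type) (F : set_system T) (FF : Filter F)
    (u : T -> R[i]^o) (l : R[i]^o) :
  u @ F --> l -> (fun t => sqmod (u t)) @ F --> sqmod l.
Proof.
move=> ul; apply: (@cvgD _ R); rewrite !expr2; under eq_fun do rewrite expr2.
  by apply: cvgM; exact: cvg_Re.
by apply: cvgM; exact: cvg_Im.
Qed.

Let complete (F : set_system H) : ProperFilter F -> cauchy F -> cvg F.
Proof.
move=> FF /cauchy_ballP Fc.
have Fn n : cvg ((fun x : H => x n) @ F).
  apply: complex_complete; apply/cauchy_ballP => e e0.
  pose ev (x : H) := x n.
  rewrite (@near_map2 _ _ _ _ ev ev F F).
  have := Fc _ e0; apply: filterS => -[x y] /=.
  rewrite -!ball_normE/=; apply: le_lt_trans.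
  by rewrite -l2N -l2D l2_coord_le.
pose u : nat -> R[i]^o := fun n => lim ((fun x : H => x n) @ F).
(* The Cauchy estimate bounds each partial sum of |x - y|^2; letting y run along the filter keeps
   the bound, uniformly in N. *)
have Fu (e : R) : 0 < e -> F [set x : H | forall N,
    \sum_(n < N) sqmod (x n - u n) <= e ^+ 2].
  move=> e0; have := Fc e%:C; rewrite ltcR => /(_ e0) [[A B]/= [FA FB] AB].
  apply: filterS FA => x Ax N.
  have cv : (fun y : H => \sum_(n < N) sqmod (x n - y n)) @ F -->
      \sum_(n < N) sqmod (x n - u n).
    apply: cvg_big => [|n _]; first exact: add_continuous.
    by apply: cvg_sqmod; apply: cvgB; [exact: cvg_cst|exact: Fn].
  apply: (cvgr_to_le cv); apply: filterS FB => y By.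
  have /= := AB (x, y) (conj Ax By); rewrite -ball_normE/= l2_norm_lt// => /ltW.
  exact: le_trans (@l2_partial_le (x - y) N).
have [x0 x0u] : exists x0 : H, forall N, \sum_(n < N) sqmod (x0 n - u n) <= 1 ^+ 2.
  by have := @filter_ex _ _ FF _ (Fu 1 ltr01).
have us : u \in @square_summable R.
  have xs : ((fun n => x0 n - u n) : nat -> R[i]^o) \in @square_summable R.
    by apply/mem_set; exists (1 ^+ 2).
  have -> : u = (x0 : nat -> R[i]^o) - (fun n => x0 n - u n).
    by apply/funext => n; rewrite !fctE subKr.
  by rewrite rpredB//; case: (x0).
apply/cvg_ex; exists (L2 us); apply/cvgrPdist_lt => e /posC[-> e0].
have e2 : 0 < Re e / 2 by rewrite divr_gt0.
have := Fu _ e2; apply: filterS => x xu.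
rewrite distrC l2_norm_lt//.
apply: (@le_lt_trans _ _ ((Re e / 2) ^+ 2)); first by apply: l2_inner_le => N; exact: xu.
by rewrite ltr_sqr ?nnegrE ?ltW// ltr_pdivrMr// ltr_pMr// ltr1n.
Qed.

HB.instance Definition _ := Uniform_isComplete.Build H complete.

End L2Hilbert.

(** * Operators *)

Section WeakOperatorClosed.
Variables (R : realType) (H : hilbertType R).

(** The topology [wot] is induced from pointwise convergence on pairs of vectors, so convergence of
    every coefficient is convergence in [wot]. *)
Lemma wot_closed_seq (A : set 'B(H)) (T : nat -> 'B(H)) (S : 'B(H)) :
  wot_closed A -> (forall n, A (T n)) ->
  (forall x y, (fun n => '[T n x, y] : R[i]^o) @ \oo --> ('[S x, y] : R[i]^o)) -> A S.
Proof.
move=> Acl AT TS; apply: (@closed_cvg nat (wot H) \oo _ T A Acl); first exact: nearW.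
move=> U [/= _ [[W oW <-]] /= WS /filterS]; apply.
suff : (fun n => matrix_coefs (T n)) @ \oo --> (matrix_coefs S : {ptws H * H -> R[i]^o}).
  by apply; exact: open_nbhs_nbhs.
apply/cvg_sup => -[x y] N [V [[W' oW' <-] /= W'S VN]]; apply: (filterS VN).
by apply: (TS x y); exact: open_nbhs_nbhs.
Qed.

End WeakOperatorClosed.

Section ComplexModulus.
Variable R : realType.
Implicit Types z w : R[i].

(** The norm of [R[i]] takes its values in [R[i]]; [cabs] is the same number in [R], where estimates
    and limits are taken. [nsq] and [nrm] below serve the same purpose for vectors. *)
Definition cabs z : R := Num.sqrt (sqmod z).

Lemma normc_cabs z : `|z| = (cabs z)%:C.
Proof. exact: normc_def. Qed.

Lemma cabs_ge0 z : 0 <= cabs z.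
Proof. exact: sqrtr_ge0. Qed.

Lemma sqr_cabs z : cabs z ^+ 2 = sqmod z.
Proof. by rewrite sqr_sqrtr ?sqmod_ge0. Qed.

Lemma cabsD z w : cabs (z + w) <= cabs z + cabs w.
Proof. by rewrite -lecR rmorphD/= -!normc_cabs ler_normD. Qed.

Lemma cabsM z w : cabs (z * w) = cabs z * cabs w.
Proof. by apply: complexI; rewrite rmorphM/= -!normc_cabs normrM. Qed.

Lemma cabs0 : cabs 0 = 0.
Proof. by apply: complexI; rewrite -normc_cabs normr0. Qed.

Lemma cabsN z : cabs (- z) = cabs z.
Proof. by apply: complexI; rewrite -!normc_cabs normrN. Qed.

Lemma cabs_conj z : cabs (Num.conj z) = cabs z.
Proof. by rewrite /cabs sqmod_conj. Qed.

Lemma cabs_real (a : R) : cabs a%:C = `|a|.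
Proof. by rewrite /cabs /sqmod/= expr0n addr0 sqrtr_sqr. Qed.

Lemma cabs_sum (I : Type) (r : seq I) (P : pred I) (F : I -> R[i]) :
  cabs (\sum_(i <- r | P i) F i) <= \sum_(i <- r | P i) cabs (F i).
Proof.
elim/big_rec2 : _ => [|i a b _]; first by rewrite cabs0.
by move=> h; rewrite (le_trans (cabsD _ _))// lerD.
Qed.

Lemma cvg_cabs (T : Type) (F : set_system T) (FF : Filter F)
    (u : T -> R[i]^o) (l : R[i]^o) :
  u @ F --> l <-> (fun t => cabs (u t - l)) @ F --> (0 : R).
Proof.
split=> [/cvgrPdist_lt ul|/cvgrPdist_lt ul].
  apply/cvgrPdist_lt => e e0; have := ul e%:C; rewrite ltcR => /(_ e0).
  apply: filterS => t; rewrite distrC normc_cabs ltcR sub0r normrN ger0_norm//.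
  exact: cabs_ge0.
apply/cvgrPdist_lt => e /posC[-> e0]; have := ul _ e0; apply: filterS => t.
by rewrite sub0r normrN ger0_norm ?cabs_ge0// distrC normc_cabs ltcR.
Qed.

End ComplexModulus.

Section RealNorm.
Variables (R : realType) (H : hilbertType R).
Implicit Types x y : H.

Definition nsq x : R := Re '[x, x].

Lemma nsqE x : '[x, x] = (nsq x)%:C.
Proof.
have := dnorm_ge0 inner x; rewrite lecE/= => /andP[/eqP e _].
by rewrite {1}['[x, x]]complexE e rmorph0 mulr0 addr0.
Qed.

Lemma nsq_ge0 x : 0 <= nsq x.
Proof. by rewrite -ler0c -nsqE dnorm_ge0. Qed.

Lemma nsqZ a x : nsq (a *: x) = sqmod a * nsq x.
Proof.
by apply: complexI; rewrite rmorphM/= -!nsqE dnormZ sqr_normC.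
Qed.

Lemma nsq0 : nsq 0 = 0.
Proof. by rewrite -(scale0r (0 : H)) nsqZ /sqmod/= expr0n addr0 mul0r. Qed.

Lemma innerC x y : '[x, y] = Num.conj '[y, x].
Proof. by rewrite hermC expr0 mul1r. Qed.

Lemma nsqD x y : '[x, y] = 0 -> nsq (x + y) = nsq x + nsq y.
Proof.
move=> xy; apply: complexI; rewrite rmorphD/= -!nsqE linearDl linearDr/=.
by rewrite linearDr/= xy (innerC y x) xy rmorph0 addr0 add0r.
Qed.

Lemma sqmod_inner x y : sqmod '[x, y] <= nsq x * nsq y.
Proof.
have := dot_CauchySchwarz inner x y.
by rewrite !nsqE sqr_normC -rmorphM lecR.
Qed.

Definition nrm x : R := Num.sqrt (nsq x).

Lemma nrm_ge0 x : 0 <= nrm x. Proof. exact: sqrtr_ge0. Qed.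

Lemma sqr_nrm x : nrm x ^+ 2 = nsq x.
Proof. by rewrite sqr_sqrtr ?nsq_ge0. Qed.

Lemma normE x : `|x| = (nrm x)%:C.
Proof.
apply/eqP; rewrite -(@eqrXn2 _ 2)// ?ler0c ?nrm_ge0//.
by rewrite sqr_normE nsqE -rmorphXn/= sqr_nrm.
Qed.

Lemma nrmD x y : nrm (x + y) <= nrm x + nrm y.
Proof. by rewrite -lecR rmorphD/= -!normE ler_normD. Qed.

Lemma nrmN x : nrm (- x) = nrm x.
Proof. by apply: complexI; rewrite -!normE normrN. Qed.

Lemma cabs_inner x y : cabs '[x, y] <= nrm x * nrm y.
Proof.
rewrite -ler_sqr ?nnegrE ?cabs_ge0 ?mulr_ge0 ?nrm_ge0//.
by rewrite exprMn !sqr_nrm sqr_cabs sqmod_inner.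
Qed.

Lemma cabs_inner_mean x y : cabs '[x, y] <= (nsq x + nsq y) / 2.
Proof.
apply: le_trans (cabs_inner _ _) _; rewrite -!sqr_nrm.
by have := sqr_ge0 (nrm x - nrm y); nra.
Qed.

Lemma innerDl x y z : '[x + y, z] = '[x, z] + '[y, z].
Proof. by rewrite linearDl. Qed.

Lemma innerDr x y z : '[x, y + z] = '[x, y] + '[x, z].
Proof. by rewrite linearDr. Qed.

Lemma innerBl x y z : '[x - y, z] = '[x, z] - '[y, z].
Proof. by rewrite linearBl. Qed.

Lemma innerBr x y z : '[x, y - z] = '[x, y] - '[x, z].
Proof. by rewrite linearBr. Qed.

Lemma innerZl a x y : '[a *: x, y] = a * '[x, y].
Proof. by rewrite linearZl_LR. Qed.

Lemma innerZr a x y : '[x, a *: y] = Num.conj a * '[x, y].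
Proof. by rewrite linearZr_LR. Qed.

Lemma inner0l x : '[0, x] = 0. Proof. by rewrite linear0l. Qed.

Lemma inner0r x : '[x, 0] = 0. Proof. by rewrite linear0r. Qed.

Lemma inner_suml (I : Type) (r : seq I) (P : pred I) (F : I -> H) x :
  '[\sum_(i <- r | P i) F i, x] = \sum_(i <- r | P i) '[F i, x].
Proof.
by elim/big_rec2 : _ => [|i a b _ <-]; [exact: inner0l|exact: innerDl].
Qed.

Lemma inner_sumr (I : Type) (r : seq I) (P : pred I) (F : I -> H) x :
  '[x, \sum_(i <- r | P i) F i] = \sum_(i <- r | P i) '[x, F i].
Proof.
by elim/big_rec2 : _ => [|i a b _ <-]; [exact: inner0r|exact: innerDr].
Qed.

Lemma inner_ext x y : (forall z, '[x, z] = '[y, z]) -> x = y.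
Proof.
move=> xy; apply/eqP; rewrite -subr_eq0 -(dnorm_eq0 inner) linearBl/=.
by rewrite !xy subrr.
Qed.

End RealNorm.

Lemma op_nrm_le (R : realType) (H K : hilbertType R) (T : 'B(H, K)) :
  exists2 c : R, 0 <= c & forall x, nrm (T x) <= c * nrm x.
Proof.
have [_ [M TM]] := boundedOpP T.
(* The bound [M] is an element of [R[i]]; a nonzero vector forces it to be a nonnegative real. *)
exists `|Re M|; first by [].
move=> x; rewrite -lecR rmorphM/= -!normE (le_trans (TM x))//.
have [->|x0] := eqVneq x 0; first by rewrite normr0 !mulr0.
have xp : 0 < `|x| by rewrite normr_gt0.
have : 0 <= M by rewrite -(pmulr_lge0 _ xp) (le_trans _ (TM x)).
case: M {TM} => a b; rewrite lecE/= => /andP[/eqP -> a0].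
by rewrite ler_pM2r// complexr0 lecR ler_norm.
Qed.

Lemma bounded_linear_nsq (R : realType) (H K : hilbertType R) (f : H -> K) (c : R) :
  linear f -> (forall x, nsq (f x) <= c * nsq x) -> f \in bounded_linear H K.
Proof.
move=> fl fc; apply/mem_set; split=> //; exists (Num.sqrt `|c|)%:C => x.
rewrite !normE -rmorphM lecR /nrm -sqrtrM// ler_wsqrtr// (le_trans (fc x))//.
by rewrite ler_wpM2r ?nsq_ge0// ler_norm.
Qed.

Section Operators.
Variables (R : realType) (H K : hilbertType R).
Implicit Types (S T : 'B(H, K)) (x y : H).

Lemma opD S T x : (S + T) x = S x + T x. Proof. by []. Qed.
Lemma opN T x : (- T) x = - T x. Proof. by []. Qed.
Lemma opZ k T x : (k *: T) x = k *: T x. Proof. by []. Qed.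
Lemma op0 x : (0 : 'B(H, K)) x = 0. Proof. by []. Qed.

Lemma op_sum (I : Type) (r : seq I) (P : pred I) (F : I -> 'B(H, K)) x :
  (\sum_(i <- r | P i) F i) x = \sum_(i <- r | P i) F i x.
Proof. by elim/big_rec2 : _ => // i y S _ <-. Qed.

Lemma opDr T x y : T (x + y) = T x + T y. Proof. exact: linearD. Qed.
Lemma opBr T x y : T (x - y) = T x - T y. Proof. exact: linearB. Qed.
Lemma opZr T k x : T (k *: x) = k *: T x. Proof. exact: linearZ. Qed.
Lemma op0r T : T 0 = 0. Proof. exact: linear0. Qed.

Lemma op_sumr (I : Type) (r : seq I) (P : pred I) (F : I -> H) T :
  T (\sum_(i <- r | P i) F i) = \sum_(i <- r | P i) T (F i).
Proof. exact: linear_sum. Qed.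

End Operators.

Lemma comp_opE (R : realType) (H K L : hilbertType R) (S : 'B(K, L)) (T : 'B(H, K)) x :
  (S \ob T) x = S (T x).
Proof. by []. Qed.

Lemma id_opE (R : realType) (H : hilbertType R) (x : H) : id_op H x = x.
Proof. by []. Qed.

(** * Rank one operators *)

Section RankOne.
Variables (R : realType) (H : hilbertType R).
Implicit Types a b x : H.

Fact rank1_subproof a b : (fun x : H => '[x, b] *: a) \in bounded_linear H H.
Proof.
apply: (@bounded_linear_nsq _ _ _ _ (nsq a * nsq b)) => [k x y|x].
  by rewrite linearPl scalerDl scalerA.
rewrite nsqZ mulrC -mulrA ler_wpM2l ?nsq_ge0// [leRHS]mulrC; exact: sqmod_inner.
Qed.

Definition rank1 a b : 'B(H) := BoundedOp (rank1_subproof a b).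

Lemma rank1E a b x : rank1 a b x = '[x, b] *: a. Proof. by []. Qed.

End RankOne.

(** * Standard basis, truncations and weak convergence in l^2 *)

Definition ell2 (R : realType) : hilbertType R := l2 R.

Section Basis.
Variable R : realType.
Local Notation H := (ell2 R).
Implicit Types x y : H.

Definition co x : nat -> R[i]^o := (x : l2 R).

Arguments co : simpl never.

Lemma co_ext x y : co x =1 co y -> x = y.
Proof. exact: l2_ext. Qed.

Lemma coD x y n : co (x + y) n = co x n + co y n. Proof. by []. Qed.
Lemma coN x n : co (- x) n = - co x n. Proof. by []. Qed.
Lemma coZ (a : R[i]) x n : co (a *: x) n = a * co x n. Proof. by []. Qed.
Lemma co0 n : co 0 n = 0. Proof. by []. Qed.

Lemma co_sum (I : Type) (r : seq I) (P : pred I) (F : I -> H) n :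
  co (\sum_(i <- r | P i) F i) n = \sum_(i <- r | P i) co (F i) n.
Proof. by elim/big_rec2 : _ => // i a b _ <-. Qed.

Definition of_seq (u : nat -> R[i]^o) (us : u \in @square_summable R) : H := L2 us.

Lemma co_of_seq u us : co (@of_seq u us) = u. Proof. by []. Qed.

Lemma co_partial_le x N : \sum_(n < N) sqmod (co x n) <= nsq x.
Proof. exact: (@l2_partial_le R x N). Qed.

Lemma nsq_le_partial x (M : R) :
  (forall N, \sum_(n < N) sqmod (co x n) <= M) -> nsq x <= M.
Proof. exact: (@l2_inner_le R x M). Qed.

Lemma co_sum_sqr x : (fun N => \sum_(n < N) sqmod (co x n)) @ \oo --> nsq x.
Proof. exact: (@l2_sum_sqr R x). Qed.

Lemma inner_cvg x y :
  (fun N => \sum_(n < N) co x n * Num.conj (co y n : R[i]) : R[i]^o) @ \oo -->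
  ('[x, y] : R[i]^o).
Proof. exact: (@l2_dot_cvg R x y). Qed.

Lemma inner_lim x y (l : R[i]^o) :
  (fun N => \sum_(n < N) co x n * Num.conj (co y n : R[i]) : R[i]^o) @ \oo --> l ->
  '[x, y] = l.
Proof. exact: (@l2_dot_lim R x y l). Qed.

Fact bvec_subproof (n : nat) : (fun m => (m == n)%:R) \in @square_summable R.
Proof.
apply/mem_set; exists 1 => N.
apply: (@le_trans _ _ (\sum_(m < N | m == n :> nat) 1)).
  rewrite [leRHS]big_mkcond; apply: ler_sum => m _ /=.
  by case: eqP => _; rewrite /sqmod/= ?expr1n ?expr0n/= addr0.
rewrite sumr_const; case: (ltnP n N) => nN.
  rewrite (_ : #|_| = 1%N)//; rewrite -(card1 (Ordinal nN)); apply: eq_card => m.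
  by rewrite !inE -val_eqE.
rewrite (_ : #|_| = 0%N)//; apply: eq_card0 => m; rewrite inE.
by apply: ltn_eqF; apply: leq_trans nN.
Qed.

Definition bvec (n : nat) : H := of_seq (bvec_subproof n).

Lemma co_bvec (n m : nat) : co (bvec n) m = (m == n)%:R. Proof. by []. Qed.

Lemma inner_bvec x (n : nat) : '[x, bvec n] = co x n.
Proof.
apply: inner_lim; apply: cvg_near_cst; exists n.+1 => // N /= nN.
rewrite (bigD1 (Ordinal nN))//= big1 ?addr0 => [|m mn].
  by rewrite co_bvec eqxx rmorph1 mulr1.
by rewrite co_bvec (_ : (_ == _) = false) ?rmorph0 ?mulr0//; apply/negbTE: mn.
Qed.

Lemma inner_bvec_l x (n : nat) : '[bvec n, x] = Num.conj (co x n : R[i]).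
Proof. by rewrite innerC inner_bvec. Qed.

Lemma nsq_bvec (n : nat) : nsq (bvec n) = 1.
Proof. by rewrite /nsq inner_bvec co_bvec eqxx. Qed.

Definition trunc N x : H := \sum_(i < N) co x i *: bvec i.

Lemma co_trunc N x n : co (trunc N x) n = if (n < N)%N then co x n else 0.
Proof.
rewrite co_sum; under eq_bigr do rewrite coZ co_bvec; case: ifPn => [nN|nN].
  rewrite (bigD1 (Ordinal nN))//= eqxx mulr1 big1 ?addr0// => i ni.
  by rewrite eq_sym (_ : (_ == _) = false) ?mulr0//; apply/negbTE: ni.
rewrite big1// => i _; rewrite (_ : (_ == _) = false) ?mulr0//.
by apply/negbTE; apply: contraNneq nN => ->.
Qed.

Lemma nsq_trunc N x : nsq (trunc N x) = \sum_(n < N) sqmod (co x n).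
Proof.
rewrite /nsq {1}/trunc inner_suml raddf_sum; apply: eq_bigr => n _ /=.
by rewrite innerZl inner_bvec_l co_trunc ltn_ord mul_conjC.
Qed.

Lemma nsq_sub_trunc N x : nsq (x - trunc N x) = nsq x - nsq (trunc N x).
Proof.
have o : '[x - trunc N x, trunc N x] = 0.
  rewrite [X in '[_, X]]/trunc inner_sumr big1// => n _.
  by rewrite innerZr inner_bvec coD coN co_trunc ltn_ord subrr mulr0.
by have := nsqD o; rewrite subrK => ->; rewrite addrK.
Qed.

Lemma nrm_sub_trunc x : (fun N => nrm (x - trunc N x)) @ \oo --> (0 : R).
Proof.
have h : (fun N => nsq (x - trunc N x)) @ \oo --> nsq x - nsq x.
  under eq_fun do rewrite nsq_sub_trunc nsq_trunc.
  by apply: cvgB; [exact: cvg_cst|exact: co_sum_sqr].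
rewrite subrr in h; rewrite -(sqrtr0 R).
by apply: continuous_cvg => //; exact: sqrt_continuous.
Qed.

Lemma nrm_trunc_le N x : nrm (trunc N x) <= nrm x.
Proof.
by rewrite ler_wsqrtr// nsq_trunc; exact: co_partial_le.
Qed.

(** By uniform boundedness x and y may be replaced by truncations at a cost independent of n; for
    truncations a coefficient is a finite sum of basis coefficients. *)
Lemma weak_cvg_basis (T : nat -> 'B(H)) (S : 'B(H)) (c : R) :
  (forall n x, nrm (T n x) <= c * nrm x) ->
  (forall i j : nat, (fun n => '[T n (bvec j), bvec i] : R[i]^o) @ \oo
     --> ('[S (bvec j), bvec i] : R[i]^o)) ->
  forall x y, (fun n => '[T n x, y] : R[i]^o) @ \oo --> ('[S x, y] : R[i]^o).
Proof.
move=> Tc TS x y; have [b b0 Sb] := op_nrm_le S.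
have c0 : 0 <= c.
  have := Tc 0%N (bvec 0); rewrite /nrm nsq_bvec sqrtr1 mulr1; apply: le_trans.
  exact: sqrtr_ge0.
have D n z : nrm ((T n - S) z) <= (b + c) * nrm z.
  rewrite opD opN addrC mulrDl (le_trans (nrmD _ _))// lerD//.
  by rewrite nrmN.
apply/cvg_cabs; apply/cvgrPdist_lt => e e0.
(* The summand 1 keeps M positive. With truncation errors below e / (2 M) the two error terms add up
   to at most (e / 2) (M - 1) / M. *)
pose M := (b + c) * (nrm x + nrm y) + 1.
have M0 : 0 < M by rewrite ltr_wpDl// mulr_ge0 ?addr_ge0 ?nrm_ge0.
have eM : 0 < e / (2 * M) by rewrite divr_gt0// mulr_gt0.
have /cvgrPdist_lt/(_ _ eM) hx := @nrm_sub_trunc x.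
have /cvgrPdist_lt/(_ _ eM) hy := @nrm_sub_trunc y.
have [N [xN yN]] : exists N, `|0 - nrm (x - trunc N x)| < e / (2 * M) /\
    `|0 - nrm (y - trunc N y)| < e / (2 * M).
  by have [N [hN1 hN2]] := filter_ex (filterI hx hy); exists N.
rewrite !sub0r !normrN !ger0_norm ?nrm_ge0// in xN yN.
have fin : (fun n => cabs '[(T n - S) (trunc N x), trunc N y]) @ \oo --> (0 : R).
  have lim : (fun n => '[T n (trunc N x), trunc N y] : R[i]^o) @ \oo -->
      ('[S (trunc N x), trunc N y] : R[i]^o).
    have E (U : 'B(H)) : '[U (trunc N x), trunc N y] =
        \sum_(j < N) \sum_(i < N) co x j * Num.conj (co y i : R[i]) * '[U (bvec j), bvec i].
      rewrite {1}/trunc op_sumr inner_suml; apply: eq_bigr => j _ /=.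
      rewrite /trunc inner_sumr; apply: eq_bigr => i _ /=.
      by rewrite opZr innerZr innerZl mulrCA mulrA.
    rewrite E; under eq_fun do rewrite E.
    apply: cvg_big => [|j _]; first exact: add_continuous.
    apply: cvg_big => [|i _]; first exact: add_continuous.
    by apply: cvgM; [exact: cvg_cst|exact: TS].
  have /cvg_cabs := lim; apply: cvg_trans; apply: near_eq_cvg; apply: nearW => n.
  by rewrite opD opN linearBl.
have /cvgrPdist_lt/(_ (e / 2)) := fin; rewrite divr_gt0// => /(_ isT).
apply: filterS => n; rewrite !sub0r !normrN !ger0_norm ?cabs_ge0// => h.
set x' := trunc N x in h *; set y' := trunc N y in h *.
have -> : '[T n x, y] - '[S x, y] = '[(T n - S) (x - x'), y] +
    ('[(T n - S) x', y - y'] + '[(T n - S) x', y']).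
  by rewrite -innerDr subrK -innerDl -opDr subrK opD opN innerBl.
apply: le_lt_trans (cabsD _ _) _; apply: le_lt_trans (lerD (lexx _) (cabsD _ _)) _.
have h1 : cabs '[(T n - S) (x - x'), y] <= (b + c) * (e / (2 * M)) * nrm y.
  apply: le_trans (cabs_inner _ _) _; apply: ler_wpM2r; first exact: nrm_ge0.
  by apply: le_trans (D _ _) _; apply: ler_wpM2l; [exact: addr_ge0|exact: ltW].
have h2 : cabs '[(T n - S) x', y - y'] <= (b + c) * nrm x * (e / (2 * M)).
  apply: le_trans (cabs_inner _ _) _.
  apply: ler_pM; [exact: nrm_ge0|exact: nrm_ge0| |exact: ltW].
  apply: le_trans (D _ _) _; apply: ler_wpM2l; first exact: addr_ge0.
  exact: nrm_trunc_le.
have -> : e = e / 2 + e / 2 by field.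
rewrite addrA; apply: ler_ltD h.
apply: le_trans (lerD h1 h2) _.
have -> : (b + c) * (e / (2 * M)) * nrm y + (b + c) * nrm x * (e / (2 * M)) =
  e / 2 * ((M - 1) / M) by rewrite /M; field; rewrite gt_eqF.
by rewrite ger_pMr ?divr_gt0// ler_pdivrMr// mul1r gerBl.
Qed.

End Basis.

(* Conversion would otherwise unfold operators down to their coordinates. *)
#[global] Opaque bvec rank1 comp_op id_op.

Lemma big_ord_block (V : nmodType) (d N : nat) (G : nat -> V) :
  \sum_(n < d * N) G n = \sum_(m < N) \sum_(r < d) G (d * m + r)%N.
Proof.
elim: N => [|N IH]; first by rewrite muln0 !big_ord0.
rewrite big_ord_recr/= -IH -!(big_mkord xpredT G) mulnS addnC.
rewrite (@big_cat_nat _ _ _ (d * N)) ?leq_addr//=; congr (_ + _).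
rewrite -{1}[(d * N)%N]add0n big_addn addKn big_mkord.
by apply: eq_bigr => r _; rewrite addnC.
Qed.

(** * Perturbed permutative isometries *)

Section Shifts.
Variables (R : realType) (d : nat).
Local Notation H := (ell2 R).
Implicit Types (x y : H) (i j : 'I_d).

Lemma ord_divn i m : ((d * m + i) %/ d)%N = m.
Proof.
have d0 : (0 < d)%N by apply: leq_ltn_trans (ltn_ord i).
by rewrite mulnC divnMDl// divn_small// addn0.
Qed.

Lemma ord_modn i m : ((d * m + i) %% d)%N = i.
Proof. by rewrite mulnC modnMDl modn_small. Qed.

Lemma sum_shift (V : nmodType) i N (a : nat -> V) :
  \sum_(n < d * N) (if (n %% d == i)%N then a (n %/ d)%N else 0) = \sum_(m < N) a m.
Proof.
rewrite (big_ord_block d N (fun n => if (n %% d == i)%N then a (n %/ d)%N else 0)).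
apply: eq_bigr => m _; rewrite (bigD1 i)//= big1 ?addr0 => [|r ri].
  by rewrite ord_modn eqxx ord_divn.
by rewrite ord_modn val_eqE (negbTE ri).
Qed.

Lemma d_gt0 i : (0 < d)%N. Proof. exact: leq_ltn_trans (ltn_ord i). Qed.

Lemma leq_dmul i N : (N <= d * N)%N.
Proof. by rewrite leq_pmull// (d_gt0 i). Qed.

Lemma partial_mono (a : nat -> R) N M : (forall n, 0 <= a n) -> (N <= M)%N ->
  \sum_(n < N) a n <= \sum_(n < M) a n.
Proof.
move=> a0 NM; rewrite -!(big_mkord xpredT a) [leRHS](@big_cat_nat _ _ _ N)//=.
by rewrite lerDl sumr_ge0.
Qed.

(** [push i] is the permutative isometry P_i, which appends i as least significant base d digit of
    the index; [pull i] is its adjoint, which reads that digit off. *)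
Definition push_fun i (u : nat -> R[i]^o) : nat -> R[i]^o :=
  fun n => if (n %% d == i)%N then u (n %/ d)%N else 0.

Definition pull_fun i (u : nat -> R[i]^o) : nat -> R[i]^o :=
  fun n => u (d * n + i)%N.

Lemma push_partial i x N :
  \sum_(n < N) sqmod (push_fun i (co x) n) <= nsq x.
Proof.
apply: (@le_trans _ _ (\sum_(n < d * N) sqmod (push_fun i (co x) n))).
  apply: (partial_mono (a := fun n => sqmod (push_fun i (co x) n))) (leq_dmul i N) => n.
  exact: sqmod_ge0.
rewrite (eq_bigr (fun n : 'I__ => if (n %% d == i)%N then sqmod (co x (n %/ d)%N) else 0)).
  by rewrite (sum_shift i N (fun m => sqmod (co x m))) co_partial_le.
by move=> n _; rewrite /push_fun; case: ifP => // _; apply/eqP; rewrite sqmod_eq0.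
Qed.

Lemma pull_partial i x N :
  \sum_(n < N) sqmod (pull_fun i (co x) n) <= nsq x.
Proof.
apply: le_trans (@co_partial_le _ x (d * N)).
rewrite (big_ord_block d N (fun n => sqmod (co x n))); apply: ler_sum => m _.
by rewrite (bigD1 i)//= lerDl sumr_ge0// => r _; exact: sqmod_ge0.
Qed.

Fact push_l2 i x : push_fun i (co x) \in @square_summable R.
Proof. by apply/mem_set; exists (nsq x) => N; exact: push_partial. Qed.

Fact pull_l2 i x : pull_fun i (co x) \in @square_summable R.
Proof. by apply/mem_set; exists (nsq x) => N; exact: pull_partial. Qed.

Fact push_subproof i : (fun x : H => of_seq (push_l2 i x)) \in bounded_linear H H.
Proof.
apply: (@bounded_linear_nsq _ _ _ _ 1) => [a x y|x].
  apply/co_ext => n; rewrite coD coZ /= /push_fun.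
  by case: ifP => //; rewrite mulr0 addr0.
by rewrite mul1r; apply: nsq_le_partial => N; exact: push_partial.
Qed.

Definition push i : 'B(H) := BoundedOp (push_subproof i).

Fact pull_subproof i : (fun x : H => of_seq (pull_l2 i x)) \in bounded_linear H H.
Proof.
apply: (@bounded_linear_nsq _ _ _ _ 1) => [a x y|x]; first exact/co_ext.
by rewrite mul1r; apply: nsq_le_partial => N; exact: pull_partial.
Qed.

Definition pull i : 'B(H) := BoundedOp (pull_subproof i).

Lemma pushE i x n : co (push i x) n = if (n %% d == i)%N then co x (n %/ d)%N else 0.
Proof. by []. Qed.

Lemma pullE i x n : co (pull i x) n = co x (d * n + i)%N.
Proof. by []. Qed.

Lemma push_adj i x y : '[push i x, y] = '[x, pull i y].
Proof.
apply/esym; apply: inner_lim; have h := @inner_cvg R (push i x) y.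
(* A partial sum of length N for [pull] is one of length d * N for [push]: a subsequence of a
   convergent sequence. *)
rewrite (_ : (fun _ => _) = (fun N => \sum_(n < N) co (push i x) n *
    Num.conj (co y n : R[i])) \o (fun N => (d * N)%N)).
  apply: cvg_comp h => A [N _ NA]; exists N => // n /= Nn; apply: NA.
  exact: leq_trans Nn (leq_dmul i n).
apply/funext => N /=.
rewrite [RHS](big_ord_block d N (fun n => co (push i x) n * Num.conj (co y n : R[i]))).
apply: eq_bigr => m _; under [RHS]eq_bigr do rewrite pushE ord_modn ord_divn.
rewrite (bigD1 i)//= eqxx big1 ?addr0// => r ri.
by rewrite val_eqE (negbTE ri) mul0r.
Qed.

Lemma pull_push i j x : pull i (push j x) = if i == j then x else 0.
Proof.
apply/co_ext => n; rewrite pullE pushE ord_modn ord_divn val_eqE.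
by case: ifP.
Qed.

Lemma sum_push_pull (d0 : (0 < d)%N) x : \sum_i push i (pull i x) = x.
Proof.
apply/co_ext => n; rewrite co_sum.
pose r := Ordinal (ltn_pmod n d0).
under eq_bigr do rewrite pushE pullE.
rewrite (bigD1 r)//= eqxx big1 ?addr0 => [|i ir]; first by rewrite mulnC -divn_eq.
by rewrite (_ : (_ == _) = false)//; apply/eqP => e; case/eqP: ir; apply/val_inj.
Qed.

Lemma push_bvec i n : push i (bvec R n) = bvec R (d * n + i).
Proof.
apply/co_ext => m; rewrite pushE !co_bvec; case: ifP => [/eqP e|ne].
  have -> : (m == d * n + i)%N = (m %/ d == n)%N; last by [].
  apply/eqP/eqP => [->|<-]; first by rewrite ord_divn.
  by rewrite {1}(divn_eq m d) e mulnC.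
case: eqP => // e; move: ne; rewrite e ord_modn eqxx.
by [].
Qed.

End Shifts.

#[global] Opaque co push pull.

Section Isometries.
Variables (R : realType) (d : nat) (d1 : (1 < d)%N).
Local Notation H := (ell2 R).
Local Notation e := (bvec R).
Variable f : H.
Hypothesis f1 : nsq f == 1.
Implicit Types (x y : H) (i j : 'I_d).

Definition l0 : 'I_d := Ordinal (ltnW d1).
Definition l1 : 'I_d := Ordinal d1.

(* [flip] has norm sqrt 2, so that [flip_op] below is a reflection. *)
Definition flip : H := push R l1 f - e 0%N.
Local Notation u := flip.

Definition flip_op : 'B(H) := id_op H - rank1 u u.

(** [ciso i] is W_i, and [cisos i] is its adjoint. *)
Definition ciso i : 'B(H) := flip_op \ob push R i.
Definition cisos i : 'B(H) := pull R i \ob flip_op.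

Lemma cisoE i x : ciso i x = flip_op (push R i x).
Proof. by rewrite /ciso comp_opE. Qed.

Lemma cisosE i x : cisos i x = pull R i (flip_op x).
Proof. by rewrite /cisos comp_opE. Qed.

Lemma flip_opE x : flip_op x = x - '[x, u] *: u.
Proof. by rewrite /flip_op opD opN rank1E. Qed.

Lemma pull_e0 i : pull R i (e 0%N) = if i == l0 then e 0%N else 0.
Proof.
apply/co_ext => n; rewrite pullE co_bvec addn_eq0 muln_eq0 -val_eqE/=.
rewrite (gtn_eqF (ltnW d1))/=.
by case: (nat_of_ord i == 0)%N; rewrite ?andbT ?andbF.
Qed.

Lemma pull_flip i :
  pull R i u = (if i == l1 then f else 0) - (if i == l0 then e 0%N else 0).
Proof. by rewrite opBr pull_push pull_e0. Qed.

Lemma inner_push_l i x y : '[x, push R i y] = '[pull R i x, y].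
Proof. by rewrite innerC push_adj -innerC. Qed.

Lemma inner_flip x : '[x, u] = '[pull R l1 x, f] - co x 0%N.
Proof. by rewrite innerBr inner_bvec inner_push_l. Qed.

Lemma flip0 : co u 0%N = -1.
Proof. by rewrite coD coN pushE mod0n co_bvec; exact: add0r. Qed.

(** P_1 f lives on indices with last digit 1, so it is orthogonal to e_0; both are unit vectors. *)
Lemma nsq_flip : '[u, u] = 2.
Proof.
rewrite inner_flip flip0 pull_flip eqxx subr0 nsqE (eqP f1).
by rewrite opprK rmorph1.
Qed.

Lemma flip_opK x : flip_op (flip_op x) = x.
Proof.
rewrite !flip_opE innerBl innerZl nsq_flip scalerBl -[in X in _ - (_ - X)]scalerA.
by apply/co_ext => n; rewrite !(coD, coN, coZ); ring.
Qed.

Lemma flip_op_adj x y : '[flip_op x, y] = '[x, flip_op y].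
Proof.
by rewrite !flip_opE innerBl innerBr innerZl innerZr -innerC mulrC.
Qed.

Lemma ciso_adj i x y : '[ciso i x, y] = '[x, cisos i y].
Proof. by rewrite cisoE cisosE flip_op_adj push_adj. Qed.

Lemma adj_ciso i : adj (ciso i) = cisos i.
Proof. by apply: adjP => x y; exact: ciso_adj. Qed.

Lemma cisosK i j x : cisos i (ciso j x) = if i == j then x else 0.
Proof. by rewrite cisosE cisoE flip_opK pull_push. Qed.

Lemma sum_ciso x : \sum_i ciso i (cisos i x) = x.
Proof.
transitivity (flip_op (\sum_(i < d) push R i (pull R i (flip_op x)))).
  by rewrite op_sumr; apply: eq_bigr => i _; rewrite cisoE cisosE.
by rewrite (sum_push_pull (ltnW d1)) flip_opK.
Qed.

Lemma ciso_cuntz : cuntz_isometries ciso.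
Proof.
split=> [i|]; apply/boundedOp_ext => x.
  by rewrite adj_ciso comp_opE cisosK eqxx id_opE.
rewrite op_sum id_opE -[RHS]sum_ciso.
by apply: eq_bigr => i _; rewrite adj_ciso comp_opE.
Qed.

Lemma cisos_expand i x : cisos i x = pull R i x - '[x, u] *: pull R i u.
Proof. by rewrite cisosE flip_opE opBr opZr. Qed.

Lemma inner_ciso i j x y : '[ciso i x, ciso j y] = if i == j then '[x, y] else 0.
Proof.
by rewrite ciso_adj cisosK; case: ifP => //; rewrite inner0r.
Qed.

Lemma flip_block i n :
  co u (d * n + i)%N = (if i == l1 then co f n else 0) - (d * n + i == 0)%N%:R.
Proof. by rewrite coD coN co_bvec pushE ord_modn ord_divn val_eqE eq_sym. Qed.

Lemma ciso_bvec i n :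
  ciso i (e n) = e (d * n + i) - Num.conj (co u (d * n + i)%N : R[i]) *: u.
Proof. by rewrite cisoE push_bvec flip_opE inner_bvec_l. Qed.

(** P_i e_n is then orthogonal to u, hence fixed by the reflection. *)
Lemma ciso_pure i n : co u (d * n + i)%N = 0 -> ciso i (e n) = e (d * n + i).
Proof. by move=> u0; rewrite ciso_bvec u0 rmorph0 scale0r subr0. Qed.

(** The reflection interchanges e_0 = P_0 e_0 and P_1 f. *)
Lemma ciso_l0_e0 : ciso l0 (e 0%N) = push R l1 f.
Proof.
have d0 : (d * 0 + l0)%N = 0%N by rewrite muln0.
rewrite ciso_bvec !d0 flip0.
by rewrite rmorphN rmorph1 scaleN1r opprK addrC /flip subrK.
Qed.

Lemma cisos_l1_e0 : cisos l1 (e 0%N) = f.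
Proof.
rewrite cisos_expand pull_flip pull_e0 eqxx inner_bvec_l flip0 rmorphN rmorph1.
rewrite (_ : (l1 == l0) = false)// subr0 scaleN1r opprK add0r.
by [].
Qed.

Fixpoint word_op (w : seq 'I_d) : 'B(H) :=
  if w is i :: w' then ciso i \ob word_op w' else id_op H.


Lemma word_op0 x : word_op [::] x = x.
Proof. exact: id_opE. Qed.

Lemma word_op_cons i w x : word_op (i :: w) x = ciso i (word_op w x).
Proof. exact: comp_opE. Qed.

Lemma inner_word w w' x y : size w = size w' ->
  '[word_op w x, word_op w' y] = if w == w' then '[x, y] else 0.
Proof.
elim: w w' => [|i w IH] [|j w']// [ww'].
by rewrite !word_op_cons inner_ciso eqseq_cons; case: (i == j) => //; rewrite andTb; exact: IH.
Qed.

Lemma nsq_word w x : nsq (word_op w x) = nsq x.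
Proof. by rewrite /nsq inner_word// eqxx. Qed.

End Isometries.

#[global] Opaque flip_op ciso cisos.

(** * Decay before the tail is entered *)

Section Stage.
Variables (R : realType) (d : nat) (d1 : (1 < d)%N).
Local Notation H := (ell2 R).
Local Notation e := (bvec R).
Local Notation l0 := (l0 d1).
Local Notation l1 := (l1 d1).

Definition below (L : nat) (x : H) := forall n : nat, (d ^ L <= n)%N -> co x n = 0.

Record stage (f F g : H) (L : nat) (theta : R) : Prop := Stage {
  stage_unit : nsq f == 1;
  stage_split : f = F + g;
  stage_below : below L F;
  stage_orth : forall x, below L x -> '[x, g] = 0;
  stage_tail : nsq g == theta
}.

Variables (f F g : H) (L : nat) (theta : R).
Hypothesis fs : stage f F g L theta.
Implicit Types (x y : H) (i j : 'I_d).

Local Notation u := (flip d1 f).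

(* [W_1^* x = P_1^* x + exitc x *: f]: the part of the last term along g leaves the
   span of the first d ^ L basis vectors, and [back] is what stays. *)
Definition exitc x : R[i] := - '[x, u].

Definition flipF : H := push R l1 F - e 0%N.

Definition back i x : H := pull R i x + exitc x *: pull R i flipF.

Lemma pull_flipF i :
  pull R i flipF = (if i == l1 then F else 0) - (if i == l0 then e 0%N else 0).
Proof. by rewrite opBr pull_push pull_e0. Qed.

Lemma cisos_back i x :
  cisos d1 f i x = back i x + (if i == l1 then exitc x *: g else 0).
Proof.
have E v : - ('[x, u] *: v) = exitc x *: v by rewrite /exitc scaleNr.
rewrite cisos_expand E pull_flip.
rewrite /back pull_flipF.
rewrite (stage_split fs).
rewrite -addrA; congr (_ + _).
case: (i == l1).
  by rewrite -scalerDr [in RHS]addrAC.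
by rewrite addr0.
Qed.

Lemma belowD x y : below L x -> below L y -> below L (x + y).
Proof. by move=> xL yL n Ln; rewrite coD xL// yL// addr0. Qed.

Lemma belowZ a x : below L x -> below L (a *: x).
Proof. by move=> xL n Ln; rewrite coZ xL// mulr0. Qed.

Lemma below0 : below L 0. Proof. by move=> n _; rewrite co0. Qed.

Lemma below_e0 : below L (e 0%N).
Proof.
move=> n Ln; rewrite co_bvec gtn_eqF// (leq_trans _ Ln)// expn_gt0.
by rewrite (ltnW d1).
Qed.

Lemma below_pull i x : below L x -> below L (pull R i x).
Proof.
move=> xL n Ln; rewrite pullE xL// (leq_trans Ln)// (leq_trans (leq_dmul i n))//.
exact: leq_addr.
Qed.

(** [pull] shortens indices, and F and e_0 lie below d ^ L. Iterating [back] thus never leaves a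
    finite-dimensional space orthogonal to g. *)
Lemma below_back i x : below L x -> below L (back i x).
Proof.
move=> xL; apply: belowD; first exact: below_pull.
apply: belowZ; rewrite pull_flipF; apply: belowD.
  by case: ifP => _; [exact: stage_below fs|exact: below0].
rewrite -scaleN1r; apply: belowZ.
by case: ifP => _; [exact: below_e0|exact: below0].
Qed.

Lemma inner_cisos x y : '[x, y] = \sum_i '[cisos d1 f i x, cisos d1 f i y].
Proof.
rewrite -{1}(sum_ciso d1 (stage_unit fs) x) inner_suml; apply: eq_bigr => i _.
by rewrite ciso_adj.
Qed.

(** The Cuntz relation splits the inner product over the letters; a part along g arises for the
    letter 1 only and is orthogonal to what stays. *)
Lemma inner_back x y : below L x -> below L y ->
  '[x, y] = exitc x * Num.conj (exitc y) * theta%:C + \sum_i '[back i x, back i y].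
Proof.
move=> xL yL; rewrite inner_cisos (bigD1 l1)//= [in RHS](bigD1 l1)//= addrA.
congr (_ + _); last first.
  by apply: eq_bigr => i /negbTE il; rewrite !cisos_back il !addr0.
rewrite !cisos_back eqxx.
move: (stage_orth fs (below_back l1 xL)) (stage_orth fs (below_back l1 yL)).
move: (back l1 x) (back l1 y) => a b ag bg.
rewrite innerDl !innerDr !innerZl !innerZr ag mulr0 addr0.
rewrite (innerC g b) bg rmorph0 mulr0 add0r.
by rewrite nsqE (eqP (stage_tail fs)) addrC mulrA.
Qed.

(** Over words of n letters, [remform] collects what has stayed in the span below d ^ L; [exitform]
    collects the coefficients along g at the moment of leaving it, over words of fewer than n
    letters. [residual] and [exits] are their diagonals. *)
Fixpoint remform n x y : R[i] :=
  if n is n'.+1 then \sum_i remform n' (back i x) (back i y) else '[x, y].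

Fixpoint exitform n x y : R[i] :=
  if n is n'.+1 then
    exitc x * Num.conj (exitc y) + \sum_i exitform n' (back i x) (back i y)
  else 0.

Fixpoint residual n x : R :=
  if n is n'.+1 then \sum_i residual n' (back i x) else nsq x.

Fixpoint exits n x : R :=
  if n is n'.+1 then sqmod (exitc x) + \sum_i exits n' (back i x) else 0.

(** Conservation of mass, by iterating [inner_back]: each exit carries the squared norm theta of
    g. *)
Lemma inner_remform n x y : below L x -> below L y ->
  '[x, y] = remform n x y + theta%:C * exitform n x y.
Proof.
elim: n x y => [|n IH] x y xL yL /=; first by rewrite mulr0 addr0.
rewrite inner_back// mulrDr mulr_sumr addrCA -big_split/= [theta%:C * _]mulrC.
by congr (_ + _); apply: eq_bigr => i _; apply: IH; exact: below_back.
Qed.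

Lemma remformxx n x : remform n x x = (residual n x)%:C.
Proof.
elim: n x => [|n IH] x /=; first exact: nsqE.
by rewrite rmorph_sum; apply: eq_bigr => i _; rewrite IH.
Qed.

Lemma exitformxx n x : exitform n x x = (exits n x)%:C.
Proof.
elim: n x => [|n IH] x //=.
rewrite rmorphD rmorph_sum mul_conjC; congr (_ + _).
by apply: eq_bigr => i _; rewrite IH.
Qed.

Lemma nsq_residual n x : below L x -> nsq x = residual n x + theta * exits n x.
Proof.
move=> xL; apply: complexI; rewrite rmorphD rmorphM/= -nsqE (inner_remform n)//.
by rewrite remformxx exitformxx.
Qed.

Lemma residual_ge0 n x : 0 <= residual n x.
Proof.
by elim: n x => [|n IH] x /=; [exact: nsq_ge0|exact: sumr_ge0].
Qed.

Lemma exits_ge0 n x : 0 <= exits n x.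
Proof.
elim: n x => [|n IH] x //=.
by rewrite addr_ge0 ?sqmod_ge0// sumr_ge0.
Qed.

Lemma cabs_remform n x y : cabs (remform n x y) <= (residual n x + residual n y) / 2.
Proof.
elim: n x y => [|n IH] x y /=; first exact: cabs_inner_mean.
rewrite -big_split mulr_suml (le_trans (cabs_sum _ _ _))//.
by apply: ler_sum => i _; exact: IH.
Qed.

Lemma nsq_pull i x : nsq (pull R i x) <= nsq x.
Proof. by apply: nsq_le_partial => N; exact: pull_partial. Qed.

Lemma sqmod_exitc x : sqmod (exitc x) <= 2 * nsq x.
Proof.
have -> : sqmod (exitc x) = sqmod '[x, u].
  by rewrite -!sqr_cabs cabsN.
apply: le_trans (sqmod_inner _ _) _; rewrite mulrC ler_wpM2r ?nsq_ge0//.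
by rewrite -lecR -nsqE (nsq_flip d1 (stage_unit fs)) rmorph_nat.
Qed.

Lemma nsq_F_le1 : nsq F <= 1.
Proof.
have := stage_unit fs; rewrite (stage_split fs) nsqD.
  by move=> /eqP <-; rewrite lerDl nsq_ge0.
exact: (stage_orth fs (stage_below fs)).
Qed.

Lemma nsq_pull_flipF i : nsq (pull R i flipF) <= 1.
Proof.
rewrite pull_flipF; case: eqP => [->|_].
  by rewrite (_ : (l1 == l0) = false)// subr0; exact: nsq_F_le1.
rewrite sub0r; case: ifP => _; last by rewrite oppr0 nsq0.
by rewrite -sqr_nrm nrmN sqr_nrm nsq_bvec.
Qed.

Fixpoint pulls (w : seq 'I_d) x : H :=
  if w is i :: w' then pulls w' (pull R i x) else x.

Lemma pullsD w x y : pulls w (x + y) = pulls w x + pulls w y.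
Proof. by elim: w x y => [|i w IH] x y //=; rewrite opDr IH. Qed.

Lemma pullsZ w a x : pulls w (a *: x) = a *: pulls w x.
Proof. by elim: w x => [|i w IH] x //=; rewrite opZr IH. Qed.

Lemma nsq_pulls w x : nsq (pulls w x) <= nsq x.
Proof.
by elim: w x => [|i w IH] x //=; apply: le_trans (IH _) (nsq_pull _ _).
Qed.

Lemma exitcD x y : exitc (x + y) = exitc x + exitc y.
Proof. by rewrite /exitc innerDl opprD. Qed.

Lemma exitcZ a x : exitc (a *: x) = a * exitc x.
Proof. by rewrite /exitc innerZl mulrN. Qed.

(** Each [pull] is replaced by [back]; the correction is a bounded vector times [exitc x], which
    [exits] has already counted. Every letter costs a factor 2 through [sqmodD]. *)
Lemma exits_pulls w x :
  sqmod (exitc (pulls w x)) <= 4 * 2 ^+ size w * exits (size w).+1 x.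
Proof.
elim: w x => [|i w IH] x.
  rewrite /= mulr1 big1// addr0 ler_peMl ?sqmod_ge0//; lra.
rewrite [pulls _ _]/=; have -> : pull R i x = back i x + (- exitc x) *: pull R i flipF.
  by rewrite /back (scaleNr (exitc x)) addrK.
rewrite pullsD pullsZ exitcD exitcZ.
apply: le_trans (sqmodD _ _) _; rewrite sqmodM.
set a := sqmod (exitc (pulls w (pull R i flipF))).
have a2 : a <= 2.
  apply: le_trans (sqmod_exitc _) _.
  by have := le_trans (nsq_pulls w _) (nsq_pull_flipF i); lra.
have a0 : 0 <= a := sqmod_ge0 _.
have -> : sqmod (- exitc x) = sqmod (exitc x) by rewrite -!sqr_cabs cabsN.
have b0 := sqmod_ge0 (exitc x).
have C1 : 1 <= (2 : R) ^+ size w by rewrite exprn_ege1// ler1n.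
have := IH (back i x); set z := exits _ _; set b := sqmod _ => bz.
have z0 : 0 <= z := exits_ge0 _ _.
have zx : sqmod (exitc x) + z <= exits (size (i :: w)).+1 x.
  rewrite [leRHS]/= lerD2l (bigD1 i)//= lerDl sumr_ge0// => j _.
  exact: (exits_ge0 (size w).+1).
have h : 0 <= 4 * 2 ^+ size (i :: w) :> R by rewrite mulr_ge0 ?exprn_ge0.
apply: le_trans (ler_wpM2l h zx); rewrite [size _]/= exprS.
nra.
Qed.

(** The word consists of the M base d digits of N, least significant first; reading them leaves only
    the coordinate N, moved to position 0. *)
Lemma below_pulls M x N : below M x -> (N < d ^ M)%N ->
  exists2 w, size w = M & pulls w x = co x N *: e 0%N.
Proof.
elim: M x N => [|M IH] x N xM NM.
  exists [::] => //; move: NM; rewrite expn0 ltnS leqn0 => /eqP ->.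
  apply/co_ext => -[|n]; rewrite coZ co_bvec; first by rewrite eqxx mulr1.
  by rewrite mulr0 xM// expn0.
pose i := Ordinal (ltn_pmod N (ltnW d1)).
have Mi : below M (pull R i x).
  by move=> n Mn; rewrite pullE xM// expnS (leq_trans _ (leq_addr _ _))// leq_mul2l Mn orbT.
have [|w ws wx] := IH _ (N %/ d)%N Mi; first by rewrite ltn_divLR ?(ltnW d1)// -expnSr.
exists (i :: w); first by rewrite /= ws.
by rewrite /= wx pullE /= mulnC -divn_eq.
Qed.

Lemma exitc_e0 : exitc (e 0%N) = 1.
Proof. by rewrite /exitc inner_bvec_l flip0 rmorphN rmorph1 opprK. Qed.

Lemma nsq_below M x : below M x -> nsq x = \sum_(n < d ^ M) sqmod (co x n).
Proof.
move=> xM; rewrite -nsq_trunc; congr nsq; apply/co_ext => n.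
by rewrite co_trunc; case: ltnP => // nM; exact: xM.
Qed.

Definition decay_const : R := (d ^ L)%:R * (4 * 2 ^+ L).

(** As e_0 has exit coefficient 1, each coordinate of x is the exit coefficient of some [pulls w x];
    [exits_pulls] is summed over the d ^ L coordinates. *)
Lemma nsq_le_exits x : below L x -> nsq x <= decay_const * exits L.+1 x.
Proof.
move=> xL; rewrite (nsq_below xL) /decay_const -mulrA mulr_natl.
rewrite -[X in _ *+ X]card_ord -sumr_const; apply: ler_sum => N _.
have [w wL wx] := below_pulls xL (ltn_ord N).
by have := exits_pulls w x; rewrite wx exitcZ exitc_e0 mulr1 wL.
Qed.

Definition decay_rate : R := 1 - theta / decay_const.

Lemma decay_const_ge1 : 1 <= decay_const.
Proof.
have h : 1 <= (2 : R) ^+ L by rewrite exprn_ege1// ler1n.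
have : 1 <= (d ^ L)%:R :> R by rewrite ler1n expn_gt0 (ltnW d1).
by rewrite /decay_const; nra.
Qed.

(** Within L + 1 letters at least the fraction theta / [decay_const] of the mass exits. *)
Lemma residual_decay x : 0 <= theta -> below L x -> residual L.+1 x <= decay_rate * nsq x.
Proof.
move=> t0 xL; have D1 := decay_const_ge1.
have D0 : 0 < decay_const by apply: lt_le_trans D1.
have := nsq_le_exits xL; have := nsq_residual L.+1 xL; rewrite /decay_rate mulrBl mul1r.
move=> h1 h2; have : theta / decay_const * nsq x <= theta * exits L.+1 x.
  by rewrite -mulrA ler_wpM2l// ler_pdivrMl.
by move: h1; move: (_ * exits _ _) (theta / _ * _) => a b; lra.
Qed.

Lemma residual_add q a n x : below L x -> (forall y, below L y -> residual a y <= q * nsq y) ->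
  residual (n + a) x <= q * residual n x.
Proof.
move=> xL aq; elim: n x xL => [|n IH] x xL; first exact: aq.
rewrite addSn /= mulr_sumr; apply: ler_sum => i _.
by apply: IH; exact: below_back.
Qed.

Lemma residual_mul (k : nat) x : 0 <= theta -> 0 <= decay_rate -> below L x ->
  residual (k * L.+1) x <= decay_rate ^+ k * nsq x.
Proof.
move=> t0 q0 xL; elim: k => [|k IH]; first by rewrite mul0n expr0 mul1r.
rewrite mulSn addnC exprS -mulrA.
apply: le_trans (residual_add _ xL (fun y => residual_decay t0 (x := y))) _.
by rewrite ler_wpM2l.
Qed.

End Stage.

(* The time n depends on L and theta only: f may still be chosen to have a
   tail g supported beyond d ^ n. *)
Lemma stage_decay (R : realType) (d : nat) (d1 : (1 < d)%N) (L : nat)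
    (theta eps : R) : 0 < theta -> theta <= 1 -> 0 < eps ->
  exists n : nat, forall f F g : ell2 R, stage d f F g L theta ->
    forall x : ell2 R, below d L x -> residual d1 f F n x <= eps * nsq x.
Proof.
move=> t0 t1 e0; set q := decay_rate d L theta.
have D1 := decay_const_ge1 R d1 L.
have D0 : 0 < decay_const R d L by apply: lt_le_trans D1.
have q0 : 0 <= q.
  by rewrite subr_ge0 ler_pdivrMr// mul1r (le_trans t1).
have q1 : q < 1 by rewrite ltrBlDr ltrDl divr_gt0.
have : (fun j : nat => q ^+ j) @ \oo --> (0 : R).
  by apply: cvg_expr; rewrite ger0_norm.
move=> /cvgrPdist_lt/(_ _ e0)[j _ /(_ j (leqnn _))/=].
rewrite sub0r normrN ger0_norm ?exprn_ge0// => qe.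
exists (j * L.+1)%N => f F g fs x xL.
apply: le_trans (residual_mul d1 fs j (ltW t0) q0 xL) _.
by rewrite ler_wpM2r ?nsq_ge0// ltW.
Qed.

(** * Passage operators *)

Section CornerSystem.
Variables (R : realType) (d : nat) (d1 : (1 < d)%N).
Local Notation H := (ell2 R).
Local Notation e := (bvec R).
Local Notation l0 := (l0 d1).
Local Notation l1 := (l1 d1).
Variables (V : Type) (act : V -> 'I_d -> V).

(* [A s t] abstracts the operators T for which the (s, t) matrix unit tensored
   with T lies in the algebra. With V a point it is the algebra generated by W. *)
Record corner_system (W : 'I_d -> 'B(H)) (A : V -> V -> set 'B(H)) : Prop := CornerSystem {
  corner0 : forall s t, A s t 0;
  corner_lin : forall s t (a : R[i]) S T, A s t S -> A s t T -> A s t (a *: S + T);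
  corner_comp : forall s r t S T, A s r S -> A r t T -> A s t (S \ob T);
  corner_gen : forall s i, A s (act s i) (W i);
  corner_closed : forall s t (T : nat -> 'B(H)) (S : 'B(H)), (forall n, A s t (T n)) ->
    (forall x y, (fun n => '[T n x, y] : R[i]^o) @ \oo --> ('[S x, y] : R[i]^o)) ->
    A s t S
}.

Variables (f F g : H) (L : nat) (theta : R).
Hypothesis fs : stage d f F g L theta.
Implicit Types (x y z : H) (i j : 'I_d) (s t : V).

Local Notation u := (flip d1 f).
Local Notation W := (ciso d1 f).
Local Notation Ws := (cisos d1 f).
Local Notation word := (word_op d1 f).
Local Notation exitc := (exitc d1 f).
Local Notation back := (back d1 f F).
Local Notation exits := (exits d1 f F).
Local Notation exitform := (exitform d1 f F).

Variables (m : nat) (v : V -> seq 'I_d).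

(** The m zeros answer the run of zeros in g; [v s] is left to steer the state s to a prescribed
    one. *)
Definition route s : 'B(H) := word (nseq m l0 ++ v s).

(* The sum, over all words that enter g for the first time within n letters, of
   the word followed by the route of the state so reached, weighted by the
   coefficient with which x enters g along that word. *)
Fixpoint passage n x s : 'B(H) :=
  if n is n'.+1 then
    exitc x *: (W l1 \ob route (act s l1)) + \sum_i (W i \ob passage n' (back i x) (act s i))
  else 0.

Lemma passage0 x s z : passage 0 x s z = 0.
Proof. by []. Qed.

Lemma passageS n x s z : passage n.+1 x s z =
  exitc x *: W l1 (route (act s l1) z) + \sum_i W i (passage n (back i x) (act s i) z).
Proof.
rewrite -[passage _ _ _]/(exitc x *: (W l1 \ob route (act s l1)) +
  \sum_i (W i \ob passage n (back i x) (act s i))).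
by rewrite opD opZ comp_opE op_sum; congr (_ + _).
Qed.

Lemma word_cat w w' x : word (w ++ w') x = word w (word w' x).
Proof.
elim: w => [|i w IH]; first by rewrite cat0s word_op0.
by rewrite cat_cons word_op_cons IH -word_op_cons.
Qed.

Lemma inner_passageS n x s z y : '[passage n.+1 x s z, y] =
  exitc x * '[route (act s l1) z, Ws l1 y] +
  \sum_i '[passage n (back i x) (act s i) z, Ws i y].
Proof.
rewrite passageS innerDl innerZl ciso_adj inner_suml; congr (_ + _).
by apply: eq_bigr => i _; rewrite ciso_adj.
Qed.

(* h is supported on positive multiples of d ^ n: its expansion begins with n
   letters 0. *)
Definition zdiv n (h : H) := co h 0%N = 0 /\ forall k : nat, ~~ (d ^ n %| k)%N -> co h k = 0.

(** Multiples of d have last digit 0, and the coordinate 0 is excluded, so h is orthogonal to u and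
    the adjoint of W_i acts on it as that of P_i. *)
Lemma zdiv_cisos n h i : zdiv n.+1 h ->
  zdiv n (Ws i h) /\ (i != l0 -> Ws i h = 0).
Proof.
move=> [h0 hd].
have p0 j : (0 < nat_of_ord j)%N -> pull R j h = 0.
  move=> j0; apply/co_ext => k; rewrite pullE hd// expnS.
  apply/negP => /(dvdn_trans (dvdn_mulr _ (dvdnn d))).
  by rewrite dvdn_addr ?dvdn_mulr// gtnNdvd.
have hu : '[h, u] = 0 by rewrite inner_flip h0 p0// inner0l subrr.
have E : Ws i h = pull R i h by rewrite cisos_expand hu scale0r subr0.
rewrite E; split=> [|i0]; last by apply: p0; rewrite lt0n.
have [i0|i0] := posnP (nat_of_ord i); last by rewrite p0//; split=> [|j _]; rewrite co0.
split=> [|j nj]; first by rewrite pullE muln0 add0n i0.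
by rewrite pullE i0 addn0 hd// expnS dvdn_pmul2l// (ltnW d1).
Qed.

(** Every word of the passage has its entry letter 1 among its first n letters, where h has only
    zeros. *)
Lemma passage_tail n x s z h : zdiv n h -> '[passage n x s z, h] = 0.
Proof.
elim: n x s h => [|n IH] x s h hn; first by rewrite passage0 inner0l.
rewrite inner_passageS (zdiv_cisos l1 hn).2// inner0r mulr0 add0r big1// => i _.
by apply: IH; exact: (zdiv_cisos i hn).1.
Qed.

Lemma nseq_passage n k x s y z : (n <= k)%N ->
  '[word (nseq k l0) y, passage n x s z] = 0.
Proof.
elim: n k x s => [|n IH] k x s; first by rewrite passage0 inner0r.
case: k => // k nk; rewrite [nseq _ _]/= word_op_cons passageS.
have f1 := stage_unit fs.
rewrite innerDr innerZr (inner_ciso d1 f1) (_ : (l0 == l1) = false)// mulr0 add0r.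
rewrite inner_sumr big1// => i _; rewrite (inner_ciso d1 f1); case: eqP => // _; exact: IH.
Qed.

Lemma nsq_sum_ciso (h : 'I_d -> H) : nsq (\sum_i W i (h i)) = \sum_i nsq (h i).
Proof.
apply: complexI; rewrite rmorph_sum -nsqE inner_suml; apply: eq_bigr => i _.
rewrite inner_sumr (bigD1 i)//= big1 ?addr0 => [|j ji].
  by rewrite (inner_ciso d1 (stage_unit fs)) eqxx nsqE.
by rewrite (inner_ciso d1 (stage_unit fs)) eq_sym (negbTE ji).
Qed.

(** The words of the passage have pairwise orthogonal ranges: after an entry the route continues
    with m >= n zeros, and by [nseq_passage] no later entry begins like this. The passage is
    therefore a multiple of an isometry. *)
Lemma nsq_passage n x s z : (n <= m)%N -> nsq (passage n x s z) = exits n x * nsq z.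
Proof.
elim: n x s => [|n IH] x s nm; first by rewrite passage0 nsq0 mul0r.
have -> : passage n.+1 x s z = \sum_i W i ((if i == l1 then
    exitc x *: route (act s l1) z else 0) + passage n (back i x) (act s i) z).
  rewrite passageS; under [RHS]eq_bigr do rewrite opDr.
  rewrite [RHS]big_split; congr (_ + _).
  rewrite [RHS](bigD1 l1)// eqxx opZr [X in _ = _ X]big1 => [|i /negbTE ->]; last exact: op0r.
  exact/esym/addr0.
rewrite nsq_sum_ciso -[exits _ _]/(_ + _) mulrDl mulr_suml (bigD1 l1)// [in RHS](bigD1 l1)//.
rewrite eqxx [RHS]addrA; congr (_ + _).
  rewrite nsqD ?IH ?(ltnW nm)// ?nsqZ.
    by rewrite nsq_word// (stage_unit fs).
  rewrite innerZl /route word_cat nseq_passage ?mulr0//.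
  exact: ltnW.
apply: eq_bigr => i /negbTE ->; rewrite add0r; apply: IH; exact: ltnW.
Qed.

Lemma zero_letter_below M y : below d M.+1 y -> below d M (Ws l0 y).
Proof.
move=> yM; rewrite cisos_expand pull_flip eqxx sub0r scalerN opprK.
apply: belowD; last by apply: belowZ; exact: below_e0.
by move=> n Mn; rewrite pullE yM// addn0 expnS leq_mul2l Mn orbT.
Qed.

Lemma zero_letter_e0 : Ws l0 (e 0%N) = 0.
Proof.
rewrite cisos_expand pull_flip pull_e0 eqxx inner_bvec_l flip0.
by rewrite rmorphN rmorph1 scaleN1r opprK sub0r subrr.
Qed.

(** M letters 0 shorten y to a multiple of e_0, and one more kills e_0, which is W_1 f and hence
    orthogonal to the range of W_0. *)
Lemma zeros_below k M y z : below d M y -> (M < k)%N -> '[word (nseq k l0) z, y] = 0.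
Proof.
elim: M k y z => [|M IH] [|k]// y z yM Mk; rewrite [nseq _ _]/= word_op_cons ciso_adj.
  have -> : y = co y 0%N *: e 0%N.
    apply/co_ext => -[|n]; rewrite coZ co_bvec; first by rewrite eqxx mulr1.
    by rewrite mulr0 yM// expn0.
  by rewrite opZr zero_letter_e0 scaler0 inner0r.
by apply: IH => //; exact: zero_letter_below.
Qed.

Hypothesis Lm : (L < m)%N.

(** Of the four products after the letter 1, two vanish: the route starts with more than L zeros and
    misses [back l1 y], and the continued passage misses g by [passage_tail]. *)
Lemma inner_passage_back n x s z y : zdiv n g -> below d L y ->
  '[passage n.+1 x s z, y] =
  exitc x * Num.conj (exitc y) * '[route (act s l1) z, g] +
  \sum_i '[passage n (back i x) (act s i) z, back i y].
Proof.
move=> gn yL; rewrite inner_passageS; congr (_ + _).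
  rewrite (cisos_back d1 fs) eqxx innerDr innerZr {1}/route word_cat.
  by rewrite (zeros_below _ (below_back d1 fs l1 yL) Lm) add0r mulrA.
apply: eq_bigr => i _; rewrite (cisos_back d1 fs) innerDr.
case: eqP => _; last by rewrite inner0r addr0.
by rewrite innerZr (passage_tail _ _ _ gn) mulr0 addr0.
Qed.

Lemma zdivW n h : zdiv n.+1 h -> zdiv n h.
Proof.
move=> [h0 hd]; split=> // j nj; apply: hd; apply: contra nj.
by apply: dvdn_trans; rewrite expnS dvdn_mull.
Qed.

(** This is why [passage] is weighted by [exitc x]: its coefficients reproduce [exitform], which
    [inner_remform] compares with the inner product of x and y. *)
Lemma inner_passage_const n x s z y (eta : R[i]) : zdiv n g -> below d L y ->
  (forall t, '[route t z, g] = eta) ->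
  '[passage n x s z, y] = eta * exitform n x y.
Proof.
move=> gn yL zg; elim: n x s y gn yL => [|n IH] x s y gn yL.
  by rewrite passage0 inner0l mulr0.
have gn' := zdivW gn.
rewrite inner_passage_back// zg /= mulrDr mulr_sumr mulrC; congr (_ + _).
by apply: eq_bigr => i _; apply: IH => //; apply: (below_back d1 fs).
Qed.

Lemma inner_passage_le n x s z y (delta : R) : zdiv n g -> below d L y ->
  (forall t, cabs '[route t z, g] <= delta) ->
  cabs '[passage n x s z, y] <= delta * ((exits n x + exits n y) / 2).
Proof.
move=> gn yL zg.
have dl0 : 0 <= delta by apply: le_trans (cabs_ge0 _) (zg s).
elim: n x s y gn yL => [|n IH] x s y gn yL.
  by rewrite passage0 inner0l cabs0 addr0 mul0r mulr0.
have gn' := zdivW gn.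
rewrite inner_passage_back//; apply: le_trans (cabsD _ _) _.
have -> : delta * ((exits n.+1 x + exits n.+1 y) / 2) =
    delta * ((sqmod (exitc x) + sqmod (exitc y)) / 2) +
    \sum_i delta * ((exits n (back i x) + exits n (back i y)) / 2).
  by rewrite -mulr_sumr -mulr_suml big_split/=; field.
apply: lerD.
  rewrite !cabsM cabs_conj mulrC; apply: ler_pM => //; rewrite ?cabs_ge0 ?mulr_ge0 ?cabs_ge0//.
  rewrite -!sqr_cabs; have := sqr_ge0 (cabs (exitc x) - cabs (exitc y)).
  by move: (cabs _) (cabs _) => a b; nra.
apply: le_trans (cabs_sum _ _ _) _; apply: ler_sum => i _.
by apply: IH => //; apply: (below_back d1 fs).
Qed.

Variables (A : V -> V -> set 'B(H)) (CA : corner_system W A).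

(** The empty word is excluded since a corner system need not contain the identity. *)
Lemma corner_word s w : (0 < size w)%N -> A s (foldl act s w) (word w).
Proof.
elim: w s => // i [|j w] IH s _.
  rewrite (_ : word [:: i] = W i); first exact: (corner_gen CA).
  by apply/boundedOp_ext => x; rewrite word_op_cons word_op0.
exact: (corner_comp CA) (corner_gen CA s i) (IH _ isT).
Qed.

Lemma corner_sum s t (I : Type) (r : seq I) (P : pred I) (T : I -> 'B(H)) :
  (forall k : I, P k -> A s t (T k)) -> A s t (\sum_(k <- r | P k) T k).
Proof.
move=> AT; elim/big_ind : _ => // [|S S' AS AS']; first exact: (corner0 CA).
by rewrite -[S]scale1r; exact: (corner_lin CA).
Qed.

Lemma corner_passage n x s t :
  (forall r, foldl act r (nseq m l0 ++ v r) = t) -> A s t (passage n x s).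
Proof.
move=> vt; elim: n x s => [|n IH] x s; first exact: (corner0 CA).
have AY r : A r t (route r).
  rewrite -(vt r); apply: corner_word; rewrite size_cat size_nseq.
  by rewrite ltn_addr// (leq_ltn_trans _ Lm).
rewrite [passage _ _ _]/=; apply: (corner_lin CA).
  exact: (corner_comp CA) (corner_gen CA s l1) (AY _).
apply: corner_sum => i _; exact: (corner_comp CA) (corner_gen CA s i) (IH _ _).
Qed.

End CornerSystem.

(** * The spread vector *)

Section WordNumbers.
Variables (d : nat) (d1 : (1 < d)%N).
Implicit Types w v : seq 'I_d.

(** The number with base d digits, least significant first, w followed by those of b. *)
Definition word_num w (b : nat) : nat := foldr (fun (i : 'I_d) n => d * n + i)%N b w.

Lemma word_num_bounds w b :
  (b * d ^ size w <= word_num w b < b.+1 * d ^ size w)%N.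
Proof.
elim: w => [|i w /andP[lo hi]]; first by rewrite /= !muln1 leqnn/=.
rewrite /= expnS mulnCA (leq_trans (leq_mul (leqnn d) lo)) ?leq_addr//=.
rewrite mulnCA; apply: (@leq_trans (d * (word_num w b).+1)).
  by rewrite mulnS addnC ltn_add2r.
by rewrite leq_mul2l hi orbT.
Qed.

Lemma word_num_inj w v b c : size w = size v ->
  word_num w b = word_num v c -> w = v /\ b = c.
Proof.
elim: w v => [|i w IH] [|j v]//= [sz] e.
have ij : i = j.
  by apply/val_inj; rewrite /= -(ord_modn i (word_num w b)) e ord_modn.
have [|-> ->//] := IH v sz; last by rewrite ij.
by rewrite -(ord_divn i (word_num w b)) e ord_divn.
Qed.

(** The lowest digit of b is nonzero, so at most |w| zeros stand at the low end. *)
Lemma word_num_ndvd w b : ~~ (d %| b)%N -> ~~ (d ^ (size w).+1 %| word_num w b)%N.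
Proof.
move=> nb; elim: w => [|i w IH]; first by rewrite expn1.
rewrite [size _]/= [word_num _ _]/= expnS.
have [i0|i0] := posnP (nat_of_ord i).
  by rewrite i0 addn0 dvdn_pmul2l ?(ltnW d1).
apply/negP => /(dvdn_trans (dvdn_mulr _ (dvdnn d))).
by rewrite dvdn_addr ?dvdn_mulr// gtnNdvd.
Qed.

Lemma word_num_zeros k w b :
  word_num (nseq k (l0 d1) ++ w) b = (d ^ k * word_num w b)%N.
Proof.
elim: k => [|k IH]; first by rewrite mul1n.
by rewrite [nseq _ _]/= cat_cons /= IH addn0 expnS mulnA.
Qed.

Lemma word_num_gt0 w b : (0 < b)%N -> (0 < word_num w b)%N.
Proof.
move=> b0; have /andP[+ _] := word_num_bounds w b; apply: leq_trans.
by rewrite muln_gt0 b0 expn_gt0 (ltnW d1).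
Qed.

End WordNumbers.

Section SpreadVector.
Variables (R : realType) (d : nat) (d1 : (1 < d)%N) (K : nat).
Variable nn : nat -> nat -> nat.
Local Notation H := (ell2 R).
Local Notation e := (bvec R).
Local Notation l0 := (l0 d1).
Local Notation l1 := (l1 d1).
Implicit Types (k l n N : nat).

(* The 2-adic valuation makes every d * q + 1 a target infinitely often; a
   target is not divisible by d, so that the W_i act on the words leading back to
   it as the P_i do. *)
Definition target k : nat := (d * logn 2 k.+1 + 1)%N.

(** The first summand is [gap k]. It exceeds the decay time, so that nearly everything has entered
    the tail before its zeros are read, and also the level itself and K. The other summands make
    room for block k below the next level. There is no circularity: [nn k] is evaluated at a level
    already fixed. *)
Fixpoint level k : nat :=
  if k is k'.+1 then
    ((maxn (nn k' (level k')) (maxn (level k') K)).+1 + K + target k' + 1)%N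
  else 1%N.

Definition gap k : nat := (maxn (nn k (level k)) (maxn (level k) K)).+1.

Lemma levelS k : level k.+1 = (gap k + K + target k + 1)%N. Proof. by []. Qed.

Lemma level_gap k : (level k < gap k)%N.
Proof. by rewrite ltnS !leq_max leqnn orbT. Qed.

Lemma nn_gap k : (nn k (level k) <= gap k)%N.
Proof. by rewrite ltnW// ltnS leq_max leqnn. Qed.

Lemma K_gap k : (K < gap k)%N.
Proof. by rewrite ltnS !leq_max leqnn !orbT. Qed.

Lemma gap_levelS k : (gap k <= level k.+1)%N.
Proof. by rewrite levelS -!addnA leq_addr. Qed.

Lemma level_mono k l : (k <= l)%N -> (level k <= level l)%N.
Proof.
move=> /subnKC <-; elim: (l - k)%N => [|n IH]; first by rewrite addn0.
rewrite addnS (leq_trans IH)// (leq_trans (ltnW (level_gap _)))//.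
exact: gap_levelS.
Qed.

Lemma gap_mono k l : (k <= l)%N -> (gap k <= gap l)%N.
Proof.
rewrite leq_eqVlt => /orP[/eqP ->//|kl].
by rewrite (leq_trans (gap_levelS k))// (leq_trans (level_mono kl))// ltnW// level_gap.
Qed.

Lemma ltn_level k : (k < level k)%N.
Proof.
elim: k => // k IH; rewrite (leq_ltn_trans IH)// (leq_trans (level_gap k))//.
exact: gap_levelS.
Qed.

Lemma target_gt0 k : (0 < target k)%N. Proof. by rewrite /target addn1. Qed.

Lemma target_ndvd k : ~~ (d %| target k)%N.
Proof. by rewrite /target dvdn_addr ?dvdn_mulr// gtnNdvd. Qed.

Lemma target_often q N : exists2 k, (N <= k)%N & target k = (d * q + 1)%N.
Proof.
(* A large number of 2-adic valuation q, less one because [target] takes the valuation of [k.+1]. *)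
exists (2 ^ q * (2 * N).+1).-1.
  rewrite -ltnS prednK ?muln_gt0 ?expn_gt0//.
  rewrite (leq_trans (_ : N < (2 * N).+1)%N)//; first by rewrite ltnS leq_pmull.
  by rewrite leq_pmull// expn_gt0.
rewrite /target prednK ?muln_gt0 ?expn_gt0// lognM ?expn_gt0//.
rewrite pfactorK// (_ : logn 2 (2 * N).+1 = 0%N) ?addn0//.
by rewrite logn_coprime// coprime2n /= mul2n odd_double.
Qed.

Definition node k (v : seq 'I_d) : nat := word_num (nseq (gap k) l0 ++ v) (target k).

Lemma node_ge k v : (d ^ gap k <= node k v)%N.
Proof.
by rewrite /node word_num_zeros leq_pmulr// word_num_gt0// target_gt0.
Qed.

Lemma node_dvd k v : (d ^ gap k %| node k v)%N.
Proof. by rewrite /node word_num_zeros dvdn_mulr. Qed.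

Lemma node_lt k v : size v = K -> (node k v < d ^ level k.+1)%N.
Proof.
move=> sv; have /andP[_] := word_num_bounds (nseq (gap k) l0 ++ v) (target k).
move=> h; apply: leq_trans h _; rewrite size_cat size_nseq sv mulnC.
have -> : level k.+1 = ((gap k + K) + (target k).+1)%N by rewrite levelS addn1 addnS.
by rewrite [X in (_ <= X)%N]expnD leq_mul2l (ltnW (ltn_expl (target k).+1 d1)) orbT.
Qed.

Lemma node_inj k v w : size v = K -> size w = K -> node k v = node k w -> v = w.
Proof.
move=> sv sw /word_num_inj[|/eqP]; first by rewrite !size_cat sv sw.
by rewrite eqseq_cat// eqxx /= => /eqP.
Qed.

(* The mass of the tail k. The ratio theta (k + 1) / theta k tends to 0, so that
   block k dominates its tail. *)
Definition theta k : R := k.+1`!%:R^-1.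

Lemma theta_gt0 k : 0 < theta k.
Proof. by rewrite invr_gt0 ltr0n fact_gt0. Qed.

Lemma theta_le1 k : theta k <= 1.
Proof. by rewrite invf_le1 ?ler1n ?ltr0n fact_gt0. Qed.

Lemma thetaS k : theta k = k.+2%:R * theta k.+1.
Proof.
rewrite /theta [k.+2`!]factS natrM invfM mulVKf//.
Qed.

(** The d ^ K nodes of block k share equally the mass by which the tail drops. *)
Definition weight k : R := Num.sqrt ((theta k - theta k.+1) / (d ^ K)%:R).

Lemma theta_sub k : theta k - theta k.+1 = k.+1%:R * theta k.+1.
Proof. by rewrite thetaS -[k.+2]addn1 natrD mulrDl mul1r addrK. Qed.

Lemma weight_sqr k : (d ^ K)%:R * weight k ^+ 2 = theta k - theta k.+1.
Proof.
have D0 : 0 < (d ^ K)%:R :> R by rewrite ltr0n expn_gt0 (ltnW d1).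
rewrite sqr_sqrtr; first by rewrite mulrC divfK// gt_eqF.
by rewrite divr_ge0// ?ltW// theta_sub mulr_gt0 ?theta_gt0.
Qed.

Lemma weight_gt0 k : 0 < weight k.
Proof.
rewrite sqrtr_gt0 divr_gt0 ?ltr0n ?expn_gt0 ?(ltnW d1)//.
by rewrite theta_sub mulr_gt0 ?theta_gt0.
Qed.

Definition block k : H := (weight k)%:C *: \sum_(v : K.-tuple 'I_d) e (node k v).

Lemma co_block k n : co (block k) n =
  (weight k)%:C * (\sum_(v : K.-tuple 'I_d) (n == node k v)%:R).
Proof. by rewrite coZ co_sum. Qed.

Lemma block_eq0 k n : ~~ (d ^ gap k <= n < d ^ level k.+1)%N || ~~ (d ^ gap k %| n)%N ->
  co (block k) n = 0.
Proof.
move=> h; rewrite co_block big1 ?mulr0// => v _; case: eqP => // nv.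
by move: h; rewrite nv node_ge node_lt ?size_tuple// node_dvd.
Qed.

Lemma nsq_block k : nsq (block k) = theta k - theta k.+1.
Proof.
rewrite nsqZ /sqmod/= expr0n addr0 -weight_sqr mulrC; congr (_ * _).
apply: complexI; rewrite -nsqE inner_suml rmorph_nat.
rewrite (eq_bigr (fun=> 1)) => [|v _]; first by rewrite sumr_const card_tuple card_ord.
rewrite inner_bvec_l co_sum (bigD1 v)//= co_bvec eqxx big1 ?addr0 ?rmorph1// => w wv.
rewrite co_bvec (_ : (_ == _) = false)//; apply/eqP => /node_inj vw.
by move/eqP: wv; apply; apply/val_inj/esym/vw; rewrite size_tuple.
Qed.

Definition partial k : H := \sum_(l < k) block l.

Lemma partialS k : partial k.+1 = partial k + block k.
Proof. by rewrite /partial big_ord_recr. Qed.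

Lemma below_partial k : below d (level k) (partial k).
Proof.
move=> n kn; rewrite co_sum big1// => l _; apply: block_eq0.
have h : (d ^ level l.+1 <= n)%N.
  by apply: leq_trans kn; rewrite leq_pexp2l ?(ltnW d1)// level_mono.
by rewrite [(n < _)%N]ltnNge h andbF.
Qed.

Lemma inner_eq0 (x y : H) : (forall n, co x n = 0 \/ co y n = 0) -> '[x, y] = 0.
Proof.
move=> xy; apply: inner_lim; apply: cvg_near_cst; apply: nearW => N.
by apply: big1 => n _; case: (xy n) => ->; rewrite ?rmorph0 ?mulr0 ?mul0r.
Qed.

Lemma nsq_partial k : nsq (partial k) = 1 - theta k.
Proof.
elim: k => [|k IH].
  by rewrite /partial big_ord0 nsq0 /theta (_ : 1`! = 1%N)// invr1 subrr.
rewrite partialS nsqD ?IH ?nsq_block; first by rewrite addrA subrK.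
apply: inner_eq0 => n; have [kn|nk] := leqP (d ^ level k) n.
  by left; exact: below_partial.
right; apply: block_eq0.
have h : (n < d ^ gap k)%N.
  by apply: leq_trans nk _; rewrite leq_pexp2l ?(ltnW d1)// ltnW// level_gap.
by rewrite [(_ <= n)%N]leqNgt h.
Qed.

Lemma co_partial k N n : (k <= N)%N -> (n < d ^ gap k)%N ->
  co (partial N) n = co (partial k) n.
Proof.
move=> /subnKC <-; elim: (N - k)%N => [|l IH] nk; first by rewrite addn0.
have h : (n < d ^ gap (k + l))%N.
  by apply: leq_trans nk _; rewrite leq_pexp2l ?(ltnW d1)// gap_mono// leq_addr.
by rewrite addnS partialS coD IH// block_eq0 ?addr0// [(_ <= n)%N]leqNgt h.
Qed.

Lemma ltn_gap n : (n < d ^ gap n)%N.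
Proof.
apply: (ltn_trans (ltn_level n)); apply: (ltn_trans (level_gap n)).
exact: ltn_expl.
Qed.

(** Coordinate n is final from [partial n] on, because n < d ^ [gap n] and later blocks lie beyond;
    no limit needs to be taken. *)
Definition spread_fun : nat -> R[i]^o := fun n => co (partial n) n.

Lemma spread_partial n N : (n <= N)%N -> spread_fun n = co (partial N) n.
Proof. by move=> nN; rewrite (co_partial nN)// ltn_gap. Qed.

Fact spread_subproof : spread_fun \in @square_summable R.
Proof.
apply/mem_set; exists 1 => N.
rewrite (eq_bigr (fun n : 'I_N => sqmod (co (partial N) n))) => [|n _].
  rewrite (le_trans (co_partial_le _ _))// nsq_partial.
  by rewrite gerBl ltW// theta_gt0.
by rewrite (spread_partial (ltnW (ltn_ord n))).
Qed.

Definition spread : H := of_seq spread_subproof.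

Lemma co_spread n N : (n <= N)%N -> co spread n = co (partial N) n.
Proof. by move=> nN; rewrite /spread co_of_seq; exact: spread_partial. Qed.

Definition tail k : H := spread - partial k.

Lemma tailS k : tail k = block k + tail k.+1.
Proof. by rewrite /tail partialS; apply/co_ext => n; rewrite !(coD, coN); ring. Qed.

Lemma co_tail0 k n : (n < d ^ gap k)%N -> co (tail k) n = 0.
Proof.
move=> nk; rewrite coD coN (co_spread (leq_maxl n k)).
by rewrite (co_partial (leq_maxr n k) nk) subrr.
Qed.

Lemma tail_zdiv k : zdiv d (gap k) (tail k).
Proof.
split=> [|n nk]; first by apply: co_tail0; rewrite expn_gt0 (ltnW d1).
rewrite coD coN (co_spread (leq_maxl n k)).
have : (k <= maxn n k)%N by rewrite leq_maxr.
move: (maxn n k) => N /subnKC <-; elim: (N - k)%N => [|l IH]; first by rewrite addn0 subrr.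
rewrite addnS partialS coD addrAC IH add0r block_eq0//; apply/orP; right.
apply: contra nk; apply: dvdn_trans.
by rewrite dvdn_exp2l// gap_mono// leq_addr.
Qed.

Lemma below_tail k x : below d (level k) x -> '[x, tail k] = 0.
Proof.
move=> xk; apply: inner_eq0 => n; have [kn|nk] := leqP (d ^ level k) n.
  by left; exact: xk.
right; apply: co_tail0; rewrite (leq_trans nk)//.
by rewrite leq_pexp2l ?(ltnW d1)// ltnW// level_gap.
Qed.

Lemma nsq_spread_split k : nsq spread = 1 - theta k + nsq (tail k).
Proof.
rewrite -nsq_partial -nsqD; first by rewrite /tail addrC subrK.
by apply: below_tail; exact: below_partial.
Qed.

Lemma nsq_spread : nsq spread = 1.
Proof.
apply/eqP; rewrite eq_le; apply/andP; split.
  apply: nsq_le_partial => N.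
  rewrite (eq_bigr (fun n : 'I_N => sqmod (co (partial N) n))) => [|n _].
    rewrite (le_trans (co_partial_le _ _))// nsq_partial.
    by rewrite gerBl ltW// theta_gt0.
  by rewrite (co_spread (ltnW (ltn_ord n))).
rewrite leNgt; apply/negP => lt1; have e0 : 0 < 1 - nsq spread by rewrite subr_gt0.
(* The squared norm is at least 1 - theta n, and theta n <= 1 / (n + 1) is as small as desired. *)
have [n _ /(_ n (leqnn _)) hn] := @near_infty_natSinv_lt R (PosNum e0).
have {}hn : n.+1%:R^-1 < 1 - nsq spread := hn.
have := nsq_ge0 (tail n); have := nsq_spread_split n.
have : theta n <= n.+1%:R^-1.
  rewrite lef_pV2 ?posrE ?ltr0n ?fact_gt0// ler_nat factS leq_pmulr//.
  exact: fact_gt0.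
move: hn; move: (nsq spread) (nsq (tail n)) (theta n) n.+1%:R^-1 => a b c e.
lra.
Qed.

Lemma nsq_tail k : nsq (tail k) = theta k.
Proof. by have := nsq_spread_split k; rewrite nsq_spread; lra. Qed.

Lemma stage_spread k : stage d spread (partial k) (tail k) (level k) (theta k).
Proof.
split; [by rewrite nsq_spread|by rewrite /tail addrC subrK|exact: below_partial| |].
  exact: below_tail.
by rewrite nsq_tail.
Qed.

Lemma spread_eq0 n : ~~ (d ^ gap 0 %| n)%N -> co spread n = 0.
Proof.
have := (tail_zdiv 0).2 n; rewrite /tail /partial big_ord0 subr0; exact.
Qed.

Lemma spread0 : co spread 0%N = 0.
Proof. by have := (tail_zdiv 0).1; rewrite /tail /partial big_ord0 subr0. Qed.

Local Notation word := (word_op d1 spread).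

(** The indices met on the way are not multiples of d ^ [gap 0], whereas f is supported on such
    multiples; so u is never touched and each letter acts as P_i. *)
Lemma word_target k w : (size w <= K)%N ->
  word w (e (target k)) = e (word_num w (target k)).
Proof.
elim: w => [|i w IH] wK; first exact: word_op0.
rewrite word_op_cons IH ?(ltnW wK)// ciso_pure// flip_block.
have := word_num_gt0 d1 w (target_gt0 k); set n := word_num w _ => n0.
rewrite (_ : (_ == 0)%N = false) ?subr0; last first.
  by rewrite addn_eq0 muln_eq0 (gtn_eqF n0) (gtn_eqF (ltnW d1)).
case: eqP => // _; apply: spread_eq0.
have := word_num_ndvd d1 w (target_ndvd k); apply: contra; apply: dvdn_trans.
by rewrite dvdn_exp2l// (leq_trans wK)// ltnW// K_gap.
Qed.

Lemma word_route k w : (size w <= K)%N ->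
  word (nseq (gap k) l0 ++ w) (e (target k)) = e (word_num (nseq (gap k) l0 ++ w) (target k)).
Proof.
move=> wK; elim: (gap k) => [|m IH]; first exact: word_target.
rewrite [nseq _ _]/= cat_cons word_op_cons IH ciso_pure// flip_block.
have := word_num_gt0 d1 (nseq m l0 ++ w) (target_gt0 k); set n := word_num _ _ => n0.
rewrite (_ : (_ == 0)%N = false) ?subr0//.
by rewrite addn_eq0 muln_eq0 (gtn_eqF n0) (gtn_eqF (ltnW d1)).
Qed.

(** The word sends the target to a node of block k, where the tail has the coefficient [weight k];
    later blocks lie beyond that node. *)
Lemma route_target k v : size v = K ->
  '[word (nseq (gap k) l0 ++ v) (e (target k)), tail k] = (weight k)%:C.
Proof.
move=> sv; rewrite word_route ?sv// -/(node k v) tailS innerDr below_tail ?addr0.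
  rewrite inner_bvec_l co_block.
  pose t := tcast sv (in_tuple v).
  have tv : tval t = v by rewrite val_tcast.
  rewrite (bigD1 t)//= tv eqxx big1 ?addr0 ?mulr1 => [|w wt].
    by apply/CrealP; rewrite complex_real.
  rewrite (_ : (_ == _) = false)//; apply/eqP => /node_inj vw.
  by move/eqP: wt; apply; apply/val_inj; rewrite /= tv; apply/esym/vw; rewrite ?size_tuple.
move=> n kn; rewrite co_bvec gtn_eqF// (leq_trans _ kn)//; exact: node_lt.
Qed.

(** Block k is itself a combination of words of the same length applied to the target. Such words
    are equal or have orthogonal ranges, so block k contributes nothing and only the later tail
    remains. *)
Lemma route_other k v j : size v = K -> j <> target k ->
  cabs '[word (nseq (gap k) l0 ++ v) (e j), tail k] <= Num.sqrt (theta k.+1).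
Proof.
move=> sv jk; rewrite tailS innerDr.
have -> : block k = (weight k)%:C *: \sum_(w : K.-tuple 'I_d)
    word (nseq (gap k) l0 ++ w) (e (target k)).
  by congr (_ *: _); apply: eq_bigr => w _; rewrite word_route ?size_tuple.
rewrite innerZr inner_sumr big1 ?mulr0 ?add0r => [|w _]; last first.
  rewrite (inner_word d1); last by rewrite !size_cat sv size_tuple.
    by case: eqP => // _; rewrite inner_bvec co_bvec; case: eqP => // /esym.
  by rewrite nsq_spread.
apply: le_trans (cabs_inner _ _) _.
have f1 : nsq spread == 1 by rewrite nsq_spread.
by rewrite /nrm (nsq_word d1 f1) nsq_bvec sqrtr1 mul1r nsq_tail.
Qed.

End SpreadVector.

(** * Full corners *)

Section FullCorners.
Variables (R : realType) (d : nat) (d1 : (1 < d)%N) (K : nat).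
Local Notation H := (ell2 R).
Local Notation e := (bvec R).
Local Notation l0 := (l0 d1).
Local Notation l1 := (l1 d1).

Fact decay_time_subproof (k : nat) : 0 < (k.+1%:R^-1 : R).
Proof. by rewrite invr_gt0 ltr0n. Qed.

(** The time after which at most the fraction 1 / (k + 1) remains. It depends on L and [theta k] but
    not on f, and can therefore enter the construction of f. *)
Definition decay_time (k L : nat) : nat :=
  projT1 (cid (stage_decay d1 L (theta_gt0 R k) (theta_le1 R k) (decay_time_subproof k))).

Definition spread_vector : H := spread R d1 K decay_time.

Definition generic_iso : 'I_d -> 'B(H) := ciso d1 spread_vector.

Local Notation f := spread_vector.
Local Notation u := (flip d1 f).
Local Notation W := generic_iso.
Local Notation Ws := (cisos d1 f).
Local Notation level := (level d K decay_time).
Local Notation gap := (gap d K decay_time).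
Local Notation partial := (partial R d1 K decay_time).
Local Notation tail := (tail R d1 K decay_time).
Local Notation target := (target d).
Local Notation theta := (theta R).
Local Notation weight := (weight R d K).
Local Notation exits := (exits d1 f).
Local Notation residual := (residual d1 f).

Lemma spread_vector1 : nsq f == 1.
Proof. by rewrite nsq_spread. Qed.

Lemma residual_decay_time k x : below d (level k) x ->
  residual (partial k) (decay_time k (level k)) x <= k.+1%:R^-1 * nsq x.
Proof.
rewrite /decay_time; case: cid => n /= nP xk.
exact: (nP _ _ _ (stage_spread R d1 K decay_time k)).
Qed.

Lemma zdiv_le n m (h : H) : (n <= m)%N -> zdiv d m h -> zdiv d n h.
Proof.
by move=> /subnKC <-; elim: (m - n)%N => [|l IH]; rewrite ?addn0// addnS => /zdivW.
Qed.

Variables (V : Type) (act : V -> 'I_d -> V).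
Hypothesis reach : forall s t, exists2 w, size w = K & foldl act s w = t.
Variable A : V -> V -> set 'B(H).
Hypothesis CA : corner_system act W A.

Lemma below_bvec k i : (i < k)%N -> below d (level k) (e i).
Proof.
move=> ik n kn; rewrite co_bvec gtn_eqF// (leq_trans _ kn)//.
rewrite (ltn_trans ik)// (ltn_trans (ltn_level d K decay_time k))//.
exact: ltn_expl.
Qed.

Lemma exits_le1 k n i : (i < k)%N -> theta k * exits (partial k) n (e i) <= 1.
Proof.
move=> ik; have fs : stage d f (partial k) (tail k) (level k) (theta k) := stage_spread R d1 K decay_time k.
have := nsq_residual d1 fs n (below_bvec ik).
by rewrite nsq_bvec => ->; rewrite lerDr residual_ge0.
Qed.

(* The passage normalised by theta k / weight k, which compensates both the mass
   of the tail and the coefficient of each node in block k. *)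
Lemma corner_step k s t : (0 < k)%N -> exists T : 'B(H), [/\ A s t T,
  forall z, nsq (T z) <= (2 * (d ^ K)%:R) * nsq z,
  forall i, (i < k)%N ->
    cabs ('[T (e (target k)), e i] - '[e 0%N, e i]) <= k.+1%:R^-1 &
  forall i j, (i < k)%N -> j <> target k ->
    cabs '[T (e j), e i] <= Num.sqrt ((d ^ K)%:R / k.+1%:R)].
Proof.
move=> k0; have fs : stage d f (partial k) (tail k) (level k) (theta k) := stage_spread R d1 K decay_time k.
have Lm := level_gap d K decay_time k.
(* Whatever state the run of zeros leads to, some word of length K continues from it to t. *)
have vE r : exists w, size w = K /\ foldl act r (nseq (gap k) l0 ++ w) = t.
  have [w wK wt] := reach (foldl act r (nseq (gap k) l0)) t.
  by exists w; rewrite foldl_cat.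
have [v vP] := choice vE.
pose n := decay_time k (level k).
have nm : (n <= gap k)%N := nn_gap d K decay_time k.
have gn : zdiv d n (tail k) := zdiv_le nm (tail_zdiv R d1 K decay_time k).
have w0 := weight_gt0 R d1 K k; have th0 := theta_gt0 R k; have th1 := theta_gt0 R k.+1.
have D0 : 0 < (d ^ K)%:R :> R by rewrite ltr0n expn_gt0 (ltnW d1).
have wsq : (d ^ K)%:R * weight k ^+ 2 = k.+1%:R * theta k.+1.
  by rewrite (weight_sqr R d1) theta_sub.
have k1 : 0 < k.+1%:R :> R by rewrite ltr0n.
exists ((theta k / weight k)%:C *: passage d1 act f (partial k) (gap k) v n (e 0%N) s).
have c2 : sqmod ((theta k / weight k)%:C : R[i]) = (theta k / weight k) ^+ 2.
  by rewrite /sqmod/= expr0n addr0.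
split.
- rewrite -[_ *: _]addr0; apply: (corner_lin CA); last exact: (corner0 CA).
  have CA' : corner_system act (ciso d1 f) A := CA.
  by apply: (corner_passage (partial k) Lm CA') => r; case: (vP r).
(* By [exits_le1] the bound is theta k / (weight k)^2 = d ^ K (k + 2) / (k + 1) <= 2 d ^ K. *)
- move=> z; rewrite opZ nsqZ c2 (nsq_passage d1 act fs v _ _ _ nm) mulrA.
  rewrite ler_wpM2r ?nsq_ge0//.
  have E1 := exits_le1 n k0; have E0 := exits_ge0 d1 f (partial k) n (e 0%N).
  have -> : (theta k / weight k) ^+ 2 * exits (partial k) n (e 0%N) =
     (theta k / weight k ^+ 2) * (theta k * exits (partial k) n (e 0%N)).
    by field; rewrite gt_eqF.
  apply: (@le_trans _ _ (theta k / weight k ^+ 2)).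
    by rewrite ler_piMr// divr_ge0 ?ltW// exprn_gt0.
  rewrite ler_pdivrMr ?exprn_gt0// -mulrA wsq thetaS mulrA ler_pM2r//.
  rewrite -[k.+2]addn1 natrD mulr_natl mulr2n lerD2l ler1n.
  by [].
(* At the target every route pairs with the tail to [weight k], so the normalised coefficient is
   theta k times [exitform]; the error is a [remform], small by the choice of the decay time. *)
- move=> i ik; rewrite opZ innerZl.
  have zg r : '[route d1 f (gap k) v r (e (target k)), tail k] = (weight k)%:C.
    by apply: route_target; case: (vP r).
  rewrite (inner_passage_const act fs Lm _ _ gn (below_bvec ik) zg).
  rewrite mulrA -rmorphM/= divfK ?gt_eqF//.
  rewrite (inner_remform d1 fs n (below_bvec k0) (below_bvec ik)).
  rewrite opprD addrCA subrr addr0 cabsN; apply: le_trans (cabs_remform _ _ _ _ _ _) _.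
  have := residual_decay_time (below_bvec k0); have := residual_decay_time (below_bvec ik).
  rewrite !nsq_bvec !mulr1 -/n => h1 h2.
  by rewrite ler_pdivrMr// mulr_natr mulr2n; exact: lerD.
(* Elsewhere only the next tail is seen, and sqrt (theta (k + 1)) / weight k = sqrt (d ^ K / (k +
   1)), since block k dominates its tail. *)
- move=> i j ik jk; rewrite opZ innerZl cabsM cabs_real ger0_norm; last first.
    by rewrite divr_ge0// ltW.
  have zg r : cabs '[route d1 f (gap k) v r (e j), tail k] <= Num.sqrt (theta k.+1).
    by apply: route_other => //; case: (vP r).
  have h := inner_passage_le act fs Lm (e 0%N) s gn (below_bvec ik) zg.
  apply: le_trans (ler_wpM2l _ h) _; first by rewrite divr_ge0// ltW.
  have E1 := exits_le1 n k0; have E2 := exits_le1 n ik.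
  apply: (@le_trans _ _ (Num.sqrt (theta k.+1) / weight k)).
    set E := _ / 2; have -> : theta k / weight k * (Num.sqrt (theta k.+1) * E) =
        Num.sqrt (theta k.+1) / weight k * (theta k * E) by ring.
    rewrite ler_piMr ?divr_ge0 ?sqrtr_ge0 ?(ltW w0)// /E mulrA ler_pdivrMr// mulrDr.
    by rewrite mul1r; lra.
  rewrite -ler_sqr ?nnegrE ?sqrtr_ge0 ?divr_ge0 ?sqrtr_ge0 ?(ltW w0)//.
  have Dk : 0 <= (d ^ K)%:R / k.+1%:R :> R by rewrite divr_ge0 ?(ltW D0) ?(ltW k1).
  rewrite expr_div_n (sqr_sqrtr (ltW th1)) (sqr_sqrtr Dk).
  by rewrite ler_pdivrMr ?exprn_gt0// mulrAC wsq mulrAC mulfV ?gt_eqF// mul1r.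
Qed.

End FullCorners.

(** * From the weak limits to all rank one operators and full corners *)

Section RankOneCorners.
Variables (R : realType) (d : nat) (d1 : (1 < d)%N) (K : nat).
Local Notation H := (ell2 R).
Local Notation e := (bvec R).
Local Notation l0 := (l0 d1).
Local Notation l1 := (l1 d1).
Local Notation f := (spread_vector R d1 K).
Local Notation u := (flip d1 f).
Local Notation W := (generic_iso R d1 K).
Local Notation Ws := (cisos d1 f).

Variables (V : Type) (act : V -> 'I_d -> V).
Hypothesis reach : forall s t, exists2 w, size w = K & foldl act s w = t.
Variable A : V -> V -> set 'B(H).
Hypothesis CA : corner_system act W A.

Implicit Types (a b c x : H) (k : R[i]) (s t : V) (i j : 'I_d).

Lemma corner_add s t (S T : 'B(H)) : A s t S -> A s t T -> A s t (S + T).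
Proof. by move=> AS AT; rewrite -[S]scale1r; exact: (corner_lin CA). Qed.

Lemma corner_scale s t k (T : 'B(H)) : A s t T -> A s t (k *: T).
Proof.
by move=> AT; rewrite -[_ *: _]addr0; apply: (corner_lin CA) AT (corner0 CA _ _).
Qed.

(** The operators of [corner_step], along stages with target d * q + 1, are uniformly bounded and
    converge on basis coefficients to the rank one operator. *)
Lemma corner_target s t q : A s t (rank1 (e 0%N) (e (d * q + 1))).
Proof.
pose D : R := (d ^ K)%:R.
have D1 : 1 <= D by rewrite ler1n expn_gt0 (ltnW d1).
have step N : exists T : 'B(H), [/\ A s t T,
    forall z, nsq (T z) <= (2 * D) * nsq z &
    forall i j : nat, (i <= N)%N ->
    cabs ('[T (e j), e i] - '[rank1 (e 0%N) (e (d * q + 1)) (e j), e i])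
      <= Num.sqrt (D / N.+1%:R)].
  have [k Nk kq] := target_often d q N.+1.
  have k0 : (0 < k)%N by apply: leq_trans Nk.
  have [T [AT Tb T1 T2]] := corner_step reach CA s t k0.
  exists T; split=> // i j iN; have ik : (i < k)%N by apply: leq_ltn_trans iN _.
  have E : '[e j, e (d * q + 1)%N] = if (d * q + 1 == j)%N then 1 else 0.
    by rewrite inner_bvec co_bvec; case: eqP.
  rewrite rank1E innerZl E.
  have kN : D / k.+1%:R <= D / N.+1%:R.
    rewrite ler_pM2l ?(lt_le_trans ltr01 D1)// lef_pV2 ?posrE ?ltr0n// ler_nat.
    by rewrite ltnS ltnW.
  (* Both estimates fit under one square root, as 1 / (k + 1) <= sqrt (D / (k + 1)) for D >= 1. *)
  apply: le_trans (ler_wsqrtr kN); have [jk|jk] := eqVneq (d * q + 1)%N j.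
    rewrite -jk mul1r -kq; apply: le_trans (T1 _ ik) _.
    have k1 : 0 < k.+1%:R^-1 :> R by rewrite invr_gt0 ltr0n.
    rewrite -[leLHS]gtr0_norm// -sqrtr_sqr ler_wsqrtr// expr2 ler_pM2r//.
    by apply: le_trans D1; rewrite invf_le1 ?ler1n ?ltr0n.
  by rewrite mul0r subr0; apply: T2 => //; rewrite kq; apply/eqP; rewrite eq_sym.
have [T TP] := choice step.
apply: (corner_closed CA (T := T)) => [n|]; first by case: (TP n).
apply: (@weak_cvg_basis R T _ (Num.sqrt (2 * D))) => [n x|i j].
  rewrite /nrm -sqrtrM ?mulr_ge0 ?ler_wsqrtr// ?(le_trans _ D1)//.
  by case: (TP n).
apply/cvg_cabs/cvgrPdist_lt => eps eps0.
have h0 : 0 < eps ^+ 2 / D by rewrite divr_gt0 ?exprn_gt0// (lt_le_trans ltr01 D1).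
have [N _ NP] := @near_infty_natSinv_lt R (PosNum h0).
exists (maxn N i) => // n /=; rewrite geq_max => /andP[Nn ni].
rewrite sub0r normrN ger0_norm ?cabs_ge0//; have [_ _ TPn] := TP n.
apply: le_lt_trans (TPn _ _ ni) _.
rewrite -[ltRHS]gtr0_norm// -sqrtr_sqr ltr_sqrt ?exprn_gt0//.
rewrite mulrC -ltr_pdivlMr ?(lt_le_trans ltr01 D1)//.
exact: (NP n Nn).
Qed.

Lemma rank1_ciso a b i : rank1 a b \ob W i = rank1 a (Ws i b).
Proof.
by apply/boundedOp_ext => x; rewrite comp_opE !rank1E ciso_adj.
Qed.

Lemma ciso_rank1 a b i : W i \ob rank1 a b = rank1 (W i a) b.
Proof. by apply/boundedOp_ext => x; rewrite comp_opE !rank1E opZr. Qed.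

Lemma rank1Dr a b c k : rank1 a (k *: b + c) = Num.conj k *: rank1 a b + rank1 a c.
Proof.
apply/boundedOp_ext => x.
by rewrite opD opZ !rank1E innerDr innerZr scalerDl scalerA.
Qed.

Lemma rank1Dl a b c k : rank1 (k *: a + b) c = k *: rank1 a c + rank1 b c.
Proof.
apply/boundedOp_ext => x.
by rewrite opD opZ !rank1E scalerDr !scalerA mulrC.
Qed.

(** At each t these vectors form a linear space, and the adjoint of W_i maps it into the one at
    [act t i]. The aim is that it contains every e_n. *)
Definition right_vec t b := forall s, A s t (rank1 (e 0%N) b).

Lemma right_vec_step t b i : right_vec t b -> right_vec (act t i) (Ws i b).
Proof.
by move=> tb s; rewrite -rank1_ciso; exact: (corner_comp CA) (tb s) (corner_gen CA t i).
Qed.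

Lemma right_vecD t b c k : right_vec t b -> right_vec t c -> right_vec t (k *: b + c).
Proof.
by move=> tb tc s; rewrite rank1Dr; exact: (corner_lin CA).
Qed.

Lemma right_vecZ t b k : k != 0 -> right_vec t (k *: b) -> right_vec t b.
Proof.
move=> k0 tb s; have := corner_scale (Num.conj k^-1) (tb s).
rewrite -[k *: b]addr0 rank1Dr scalerDr scalerA -rmorphM mulVf// rmorph1 scale1r.
have -> : rank1 (e 0%N) (0 : H) = 0.
  by apply/boundedOp_ext => x; rewrite rank1E inner0r scale0r op0.
by rewrite scaler0 addr0.
Qed.

Lemma right_vec_target t q : right_vec t (e (d * q + 1)).
Proof. by move=> s; exact: corner_target. Qed.

Lemma spread_support : exists n, co f n != 0.
Proof.
apply/not_existsP => h; have := spread_vector1 R d1 K.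
have -> : f = 0.
  by apply/co_ext => n; rewrite co0; apply/eqP; have /negP := h n; rewrite negbK.
by rewrite nsq0 eq_sym oner_eq0.
Qed.

Lemma cisos_l0 b : Ws l0 b = pull R l0 b + '[b, u] *: e 0%N.
Proof.
by rewrite cisos_expand pull_flip eqxx (_ : (l0 == l1) = false)// sub0r scalerN opprK.
Qed.

Lemma cisos_l1 b : Ws l1 b = (- '[b, u]) *: f + pull R l1 b.
Proof.
rewrite cisos_expand pull_flip eqxx (_ : (l1 == l0) = false)// subr0.
by rewrite scaleNr addrC.
Qed.

Lemma pull_bvec i j (n : nat) : pull R i (e (d * n + j)%N) = if i == j then e n else 0.
Proof. by rewrite -push_bvec pull_push. Qed.

Lemma inner_bvec_flip j (n : nat) : '[e (d * n + j)%N, u] =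
  Num.conj ((if j == l1 then co f n else 0) - (d * n + j == 0)%N%:R : R[i]).
Proof. by rewrite inner_bvec_l flip_block. Qed.

(** For n in the support of f, the adjoint of W_0 maps e_(d n + 1) to a nonzero multiple of e_0. *)
Lemma right_vec0_l0 t : right_vec (act t l0) (e 0%N).
Proof.
have [n fn] := spread_support; have := right_vec_step l0 (right_vec_target t n).
rewrite cisos_l0 (pull_bvec l0 l1) (inner_bvec_flip l1) eqxx.
rewrite (_ : (l0 == l1) = false)// add0r (_ : (_ == 0)%N = false); last first.
  by rewrite addn1.
by rewrite subr0; apply: right_vecZ; rewrite conjC_eq0.
Qed.

(** The adjoint of W_1 maps e_(d n + 1) to e_n plus a multiple of f, which can be subtracted. *)
Lemma right_vec_l1 t (n : nat) : right_vec (act t l1) f ->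
  right_vec t (e (d * n + l1)%N) -> right_vec (act t l1) (e n).
Proof.
move=> tf /(right_vec_step l1); rewrite cisos_l1 pull_bvec eqxx.
set k := - _ => h; rewrite -[e n](addKr (k *: f)) -scaleNr.
exact: right_vecD tf h.
Qed.

Lemma right_vec0_l1 t : right_vec (act t l1) (e 0%N).
Proof.
have := right_vec_step l1 (right_vec_target t 0).
rewrite cisos_l1 (pull_bvec l1 l1) (inner_bvec_flip l1) eqxx spread0.
rewrite (_ : (_ == 0)%N = false); last by rewrite addn1.
by rewrite subr0 rmorph0 oppr0 scale0r add0r.
Qed.

(** The first letter 1 yields e_0; the second turns e_0 into f and the targets into e_n up to
    multiples of f. *)
Lemma right_vec_base t (n : nat) : right_vec (act (act t l1) l1) (e n).
Proof.
apply: right_vec_l1; last exact: right_vec_target.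
rewrite -(cisos_l1_e0 d1 f); apply: right_vec_step; exact: right_vec0_l1.
Qed.

Lemma right_vec_act t i : (forall n : nat, right_vec t (e n)) ->
  forall n : nat, right_vec (act t i) (e n).
Proof.
move=> tn n; have [->|i1] := eqVneq i l1.
  apply: right_vec_l1 => //.
  by rewrite -(cisos_l1_e0 d1 f); exact: right_vec_step.
have := right_vec_step i (tn (d * n + i)%N).
have [->|i0] := eqVneq i l0.
  rewrite cisos_l0 pull_bvec eqxx; set k := '[_, _] => h.
  rewrite -[e n](addrK (k *: e 0%N)) addrC -scaleNr.
  by apply: right_vecD h; exact: right_vec0_l0.
rewrite cisos_expand pull_bvec eqxx pull_flip (negbTE i0) (negbTE i1).
by rewrite subr0 scaler0 subr0.
Qed.

Lemma right_vec_bvec t (n : nat) : right_vec t (e n).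
Proof.
have [w _ wt] := reach (act (act t l1) l1) t.
rewrite -wt; move: (right_vec_base t) n; elim: w (act (act t l1) l1) {wt} => //= i w IH r rn.
by apply: IH; exact: right_vec_act.
Qed.

(** Induction on the left index: e_n differs from W_i applied to the basis vector at the quotient n
    / d by a multiple of u = W_0 e_0 - e_0. *)
Lemma corner_rank1 s t (n q : nat) : A s t (rank1 (e n) (e q)).
Proof.
have [N] := ubnP n; elim: N n s => // N IH [|n] s nN; first exact: right_vec_bvec.
pose i := Ordinal (ltn_pmod n.+1 (ltnW d1)).
have ne : n.+1 = (d * (n.+1 %/ d) + i)%N by rewrite mulnC -divn_eq.
have WA (m : nat) j : (m < N)%N -> A s t (rank1 (W j (e m)) (e q)).
  move=> mN; rewrite -ciso_rank1.
  by apply: (corner_comp CA) (corner_gen CA s j) _; exact: IH.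
have N0 : (0 < N)%N by rewrite -ltnS (leq_trans _ nN).
have -> : e n.+1 = Num.conj (co u n.+1 : R[i]) *: W l0 (e 0%N) +
    ((- Num.conj (co u n.+1 : R[i])) *: e 0%N + W i (e (n.+1 %/ d)%N)).
  rewrite addrA scaleNr -scalerBr /generic_iso ciso_l0_e0 -/(flip d1 f) ciso_bvec -ne.
  by rewrite addrC subrK.
rewrite !rank1Dl; apply: corner_add; first by apply: corner_scale; exact: WA.
apply: corner_add; first by apply: corner_scale; exact: right_vec_bvec.
by apply: WA; apply: leq_trans (ltn_Pdiv d1 _) _.
Qed.

Lemma trunc_op N (T : 'B(H)) z :
  (\sum_(i < N) \sum_(j < N) '[T (e j), e i] *: rank1 (e i) (e j)) z
  = trunc N (T (trunc N z)).
Proof.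
rewrite op_sum; apply: eq_bigr => i _; rewrite op_sum.
rewrite /trunc op_sumr co_sum scaler_suml; apply: eq_bigr => j _.
by rewrite opZ rank1E inner_bvec inner_bvec opZr coZ scalerA mulrC.
Qed.

(** The compressions of T to the first N basis vectors are finite sums of rank one operators and
    converge weakly to T. *)
Lemma corner_full s t (T : 'B(H)) : A s t T.
Proof.
pose TN N := \sum_(i < N) \sum_(j < N) '[T (e j), e i] *: rank1 (e i) (e j).
apply: (corner_closed CA (T := TN)) => [N|].
  apply: (corner_sum CA) => i _; apply: (corner_sum CA) => j _.
  by apply: corner_scale; exact: corner_rank1.
have [b b0 Tb] := op_nrm_le T.
apply: (@weak_cvg_basis R TN T b) => [N x|i j].
  rewrite trunc_op (le_trans (nrm_trunc_le _ _))// (le_trans (Tb _))//.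
  by rewrite ler_wpM2l// nrm_trunc_le.
apply: cvg_near_cst; exists (maxn i j).+1 => // N /=; rewrite gtn_max => /andP[iN jN].
rewrite trunc_op inner_bvec co_trunc iN inner_bvec; congr (co (T _) i).
apply/co_ext => n; rewrite co_trunc co_bvec; case: ltnP => // Nn.
by rewrite (gtn_eqF (leq_trans jN Nn)).
Qed.

End RankOneCorners.

(** * Closure properties of generated WOT-closed algebras *)

Section WotAlgebra.
Variables (R : realType) (H : hilbertType R) (G : set 'B(H)).

Lemma wot_algebra_sub : G `<=` wot_algebra G.
Proof. by move=> T GT A [_]; apply. Qed.

Lemma wot_algebra_subalgebra : subalgebra (wot_algebra G).
Proof.
split=> [A [[[A0 _ _] _] _]//|a S T GS GT A|S T GS GT A].
  by move=> /[dup] h [[[_ lin _] _] _]; apply: lin; [exact: GS|exact: GT].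
by move=> /[dup] h [[[_ _ mul] _] _]; apply: mul; [exact: GS|exact: GT].
Qed.

Lemma wot_algebra_seq (T : nat -> 'B(H)) (S : 'B(H)) :
  (forall n, wot_algebra G (T n)) ->
  (forall x y, (fun n => '[T n x, y] : R[i]^o) @ \oo --> ('[S x, y] : R[i]^o)) ->
  wot_algebra G S.
Proof.
move=> GT TS A /[dup] h [[_ Acl] _].
by apply: (wot_closed_seq Acl _ TS) => n; exact: GT.
Qed.

Lemma wot_algebra_sum (I : Type) (r : seq I) (P : pred I) (T : I -> 'B(H)) :
  (forall k, wot_algebra G (T k)) -> wot_algebra G (\sum_(k <- r | P k) T k).
Proof.
have [A0 lin _] := wot_algebra_subalgebra.
move=> GT; elim/big_ind : _ => // S S' GS GS'.
by rewrite -[S]scale1r; exact: lin.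
Qed.

End WotAlgebra.

(** * The graph *)

Section Paths.
Variable G : digraph.

Lemma dipath_rcons (v : vertex G) p e w :
  dipath v (rcons p e) w = dipath v p (src e) && (rng e == w).
Proof.
elim: p v => [|a p IH] v /=; first by rewrite eq_sym.
by rewrite IH andbA.
Qed.

Lemma uniform_length : aperiodic G ->
  exists K, forall v w : vertex G, exists2 p, size p = K & dipath v p w.
Proof.
move=> ap; have [K0 K0P] : exists K0 : vertex G * vertex G -> nat,
    forall z k, (K0 z <= k)%N -> exists2 p, size p = k & dipath z.1 p z.2.
  have h (z : vertex G * vertex G) : exists K, forall k, (K <= k)%N -> exists2 p, size p = k & dipath z.1 p z.2.
    by have [K _ KP] := ap z.1 z.2; exists K.
  by have [K0 KP] := choice h; exists K0.
exists (\max_z K0 z)%N => v w; apply: (K0P (v, w)).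
exact: (leq_bigmax (v, w)).
Qed.

Variable d : nat.
Hypothesis reg : in_degree_regular G d.

Definition in_edges (v : vertex G) := enum [pred e : edge G | rng e == v].

Lemma mem_in_edges (e : edge G) : e \in in_edges (rng e).
Proof. by rewrite mem_enum inE. Qed.

Fact in_edge_index_subproof (e : edge G) : (index e (in_edges (rng e)) < d)%N.
Proof. by rewrite -(reg (rng e)) cardE index_mem mem_in_edges. Qed.

Definition colouring (e : edge G) : 'I_d := Ordinal (in_edge_index_subproof e).

Lemma colouring_strong : strong_edge_colouring colouring.
Proof.
move=> e e' ee' ne; apply: contra ne => /eqP/(congr1 val)/= h; apply/eqP.
rewrite -(nth_index e (mem_in_edges e)) h -ee' nth_index// ee'.
exact: mem_in_edges.
Qed.

(** In-degree exactly d makes the colours bijective on the edges into v: read backwards, the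
    coloured graph is a complete deterministic automaton. *)
Lemma colouring_onto v i : exists e : edge G, rng e = v /\ colouring e = i.
Proof.
have sz : size (in_edges v) = d by rewrite -cardE reg.
have [e ev ei] : exists2 e, e \in in_edges v & index e (in_edges v) = i.
  case s : (in_edges v) sz => [|e0 r] sz; first by move: (ltn_ord i); rewrite -{2}sz.
  exists (nth e0 (e0 :: r) i); first by rewrite mem_nth// sz.
  by rewrite index_uniq ?sz// -s enum_uniq.
have re : rng e = v by move: ev; rewrite mem_enum inE => /eqP.
by exists e; split => //; apply/val_inj; rewrite /= re.
Qed.

End Paths.

(** * Block matrices over the direct sum *)

Section Corners.
Variables (R : realType) (V : finType) (H : hilbertType R).
Local Notation K := (hsum V H).

(** The (s, t) matrix unit tensored with T. *)
Definition corner_op (s t : V) (T : 'B(H)) : 'B(K) :=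
  adj (coord_op H s) \ob T \ob coord_op H t.

Lemma corner_opE s t T (x : K) :
  corner_op s t T x = [ffun w => if w == s then T (x t) else 0].
Proof. by rewrite /corner_op adj_coord_op. Qed.

Lemma inner_corner s t T (x y : K) : '[corner_op s t T x, y] = '[T (x t), y s].
Proof.
rewrite corner_opE hsum_innerE (bigD1 s)//= big1 => [|w ws].
  by rewrite ffunE eqxx addr0.
by rewrite ffunE (negbTE ws) inner0l.
Qed.

Lemma corner_op_lin s t a S T :
  corner_op s t (a *: S + T) = a *: corner_op s t S + corner_op s t T.
Proof.
apply/boundedOp_ext => x; rewrite opD opZ !corner_opE opD opZ.
by apply/ffunP => w; rewrite !ffunE; case: eqP; rewrite ?scaler0 ?addr0.
Qed.

Lemma corner_op0 s t : corner_op s t 0 = 0.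
Proof.
apply/boundedOp_ext => x; rewrite corner_opE; apply/ffunP => w.
by rewrite !ffunE; case: eqP.
Qed.

Lemma corner_op_comp s r t S T :
  corner_op s r S \ob corner_op r t T = corner_op s t (S \ob T).
Proof.
apply/boundedOp_ext => x; rewrite comp_opE !corner_opE comp_opE.
by rewrite [X in S X]ffunE eqxx.
Qed.

Lemma corner_decomposition (T : 'B(K)) :
  T = \sum_s \sum_t corner_op s t (coord_op H s \ob T \ob adj (coord_op H t)).
Proof.
apply/boundedOp_ext => x; apply: inner_ext => y.
rewrite op_sum inner_suml hsum_innerE; apply: eq_bigr => s _.
rewrite op_sum inner_suml; under eq_bigr do rewrite inner_corner.
rewrite -inner_suml; congr ('[_, y s]).
under eq_bigr do rewrite !comp_opE adj_coord_op.
rewrite -op_sumr -op_sumr; congr (T _ s).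
apply/ffunP => v; rewrite sum_ffunE (bigD1 v)//= big1 ?addr0 => [|w wv].
  by rewrite ffunE eqxx.
by rewrite ffunE eq_sym (negbTE wv).
Qed.

End Corners.

(** * The two algebras for in-degree at least two *)

Section FullAlgebras.
Variables (R : realType) (d : nat) (d1 : (1 < d)%N) (K : nat).
Local Notation H := (ell2 R).
Local Notation W := (generic_iso R d1 K).

Lemma wot_algebra_full : wot_algebra (range W) = [set: 'B(H)].
Proof.
apply/seteqP; split=> // T _.
pose act (s : unit) (i : 'I_d) := tt.
have [A0 lin mul] := wot_algebra_subalgebra (range W).
have CA : corner_system act W (fun _ _ : unit => wot_algebra (range W)).
  split=> [s t|s t a S S'|s r t S S'|s i|s t S S'].
  - exact: A0.
  - exact: lin.
  - exact: mul.
  - by apply: wot_algebra_sub; exists i.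
  - exact: wot_algebra_seq.
apply: (corner_full _ CA tt tt) => -[] [].
by exists (nseq K (l0 d1)); rewrite ?size_nseq//; case: foldl.
Qed.

Variable G : digraph.
Hypothesis reg : in_degree_regular G d.
Hypothesis paths : forall v w : vertex G, exists2 p, size p = K & dipath v p w.
Local Notation c := (colouring reg).

Lemma free_semigroupoid_algebra_full :
  free_semigroupoid_algebra W c = [set: 'B(hsum (vertex G) H)].
Proof.
apply/seteqP; split=> // T _.
have onto (z : vertex G * 'I_d) : exists e : edge G, rng e = z.1 /\ c e = z.2.
  exact: colouring_onto.
have [edge_at eP] := choice onto.
(* S_e maps the summand of its source to that of its range, so letters are read against the
   arrows. *)
pose act v i := src (edge_at (v, i)).
have act_rng e : act (rng e) (c e) = src e.
  have [/= e1 e2] := eP (rng e, c e); rewrite /act.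
  have [->//|ne] := eqVneq (edge_at (rng e, c e)) e.
  by have := colouring_strong reg e1 ne; rewrite e2 eqxx.
(* The colours of a path from t to s, read backwards, lead from s to t. *)
have reach s t : exists2 w, size w = K & foldl act s w = t.
  have [p <- {T}] := paths t s.
  elim/last_ind: p s => [|p e IH] s /=; first by move/eqP ->; exists [::].
  rewrite dipath_rcons => /andP[/IH [w wp wt] /eqP <-].
  exists (c e :: w); first by rewrite /= wp size_rcons.
  by rewrite /= act_rng.
pose alg := free_semigroupoid_algebra W c.
have [A0 lin mul] : subalgebra alg := wot_algebra_subalgebra _.
have CA : corner_system act W (fun s t => [set S | alg (corner_op s t S)]).
  split=> [s t|s t a S S' /= AS AS'|s r t S S' /= AS AS'|s i|s t S S' AS SS'] /=.
  - by rewrite corner_op0.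
  - by rewrite corner_op_lin; exact: lin.
  - by rewrite -(corner_op_comp s r t); exact: mul.
  - apply: wot_algebra_sub; right; exists (edge_at (s, i)) => //.
    by have [/= e1 e2] := eP (s, i); rewrite /CK_edge e1 e2.
  - apply: (@wot_algebra_seq _ _ _ (fun n => corner_op s t (S n))) => // x y.
    rewrite inner_corner; under eq_fun do rewrite inner_corner.
    exact: SS'.
rewrite (corner_decomposition T); apply: wot_algebra_sum => s.
by apply: wot_algebra_sum => t; exact: (corner_full reach CA).
Qed.

End FullAlgebras.

(** * In-degree one *)

Section OneColour.
Variables (R : realType) (G : digraph).
Hypothesis ap : aperiodic G.
Hypothesis reg : in_degree_regular G 1.
Local Notation H := (chilb R).

Lemma in_edge_unique (e e' : edge G) : rng e = rng e' -> e = e'.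
Proof.
move=> ee'; have /card_le1_eqP : (#|[pred a : edge G | rng a == rng e]| <= 1)%N.
  by rewrite (reg (rng e)).
by apply; rewrite inE ?ee'.
Qed.

(** With one edge into every vertex, a path is determined by its end and its length; paths of equal
    length from v and from w to a common end thus have the same start. *)
Lemma one_vertex (v w : vertex G) : v = w.
Proof.
have [K paths] := uniform_length ap.
have [p pK vp] := paths v w; have [q qK wq] := paths w w.
suff H1 r r' x : dipath v r x -> dipath w r' x -> size r = size r' -> v = w.
  by apply: H1 vp wq _; rewrite pK qK.
elim/last_ind: r r' x => [|r e IH] r' x; first by case: r' => //= /eqP-> /eqP->.
case/lastP: r' => [_ _|r' e']; first by rewrite size_rcons.
rewrite !dipath_rcons => /andP[re /eqP ex] /andP[re' /eqP ex'].
rewrite !size_rcons => -[]; apply: IH re _.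
by rewrite (in_edge_unique (etrans ex (esym ex'))).
Qed.

Lemma chilb_scalar (T : 'B(H)) : T = T (1 : R[i]) *: id_op H.
Proof.
apply/boundedOp_ext => x; rewrite opZ id_opE.
rewrite {1}(_ : x = (x : R[i]) *: (1 : H)) ?opZr; last exact/esym/mulr1.
exact: mulrC.
Qed.

Lemma in_degree_one (G_nonempty : (0 < #|vertex G|)%N) :
  exists (H : hilbertType R) (W : 'I_1 -> 'B(H)) (c : edge G -> 'I_1),
    [/\ exists x : H, x != 0,
        cuntz_isometries W,
        wot_algebra (range W) = [set: 'B(H)],
        strong_edge_colouring c
      & free_semigroupoid_algebra W c = [set: 'B(hsum (vertex G) H)]].
Proof.
have [v _] : exists v, v \in vertex G by apply/card_gt0P.
have adj_id : adj (id_op H) = id_op H by apply: adjP => x y; rewrite !id_opE.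
exists H, (fun=> id_op H), (fun=> ord0); split.
- by exists (1 : R[i]); exact: oner_neq0.
- split=> [i|]; last rewrite big_ord1; rewrite adj_id;
    by apply/boundedOp_ext => x; rewrite comp_opE !id_opE.
- apply/seteqP; split=> // T _; rewrite (chilb_scalar T) -[_ *: _]addr0.
  have [A0 lin _] := wot_algebra_subalgebra (range (fun _ : 'I_1 => id_op H)).
  by apply: lin => //; apply: wot_algebra_sub; exists ord0.
- by move=> e e' /in_edge_unique ->; rewrite eqxx.
- apply/seteqP; split=> // T _.
  pose one : hsum (vertex G) H := [ffun=> 1 : R[i]].
  (* The only summand is a complex line, so the vertex projection is the identity and every operator
     is a multiple of it. *)
  have -> : T = (T one v : R[i]) *: CK_vertex H v.
    apply/boundedOp_ext => x; rewrite opZ.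
    have vx (y : hsum (vertex G) H) : y = (y v : R[i]) *: one.
      apply/ffunP => w; rewrite !ffunE (one_vertex w v); exact/esym/mulr1.
    rewrite [in LHS](vx x) opZr.
    have -> : CK_vertex H v x = x.
      by apply/ffunP => w; rewrite ffunE (one_vertex w v) eqxx.
    rewrite [in LHS](vx (T one)) [in RHS](vx x) !scalerA; congr (_ *: _).
    exact: mulrC.
  have [A0 lin _] := wot_algebra_subalgebra (range (@CK_vertex R G H) `|`
    range (CK_edge (fun=> id_op H) (fun=> ord0 : 'I_1))).
  rewrite -[_ *: _]addr0; apply: lin => //; apply: wot_algebra_sub.
  by left; exists v.
Qed.

End OneColour.

(** * Cases on the in-degree *)

Theorem theorem10p8 (R : realType) (G : digraph) (d : nat)
    (G_nonempty : (0 < #|vertex G|)%N)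
    (G_transitive : transitive_graph G)
    (G_aperiodic : aperiodic G)
    (G_regular : in_degree_regular G d) :
  exists (H : hilbertType R) (W : 'I_d -> 'B(H)) (c : edge G -> 'I_d),
    [/\ exists x : H, x != 0,
        cuntz_isometries W,
        wot_algebra (range W) = [set: 'B(H)],
        strong_edge_colouring c
      & free_semigroupoid_algebra W c = [set: 'B(hsum (vertex G) H)]].
Proof.
have [v _] : exists v, v \in vertex G by apply/card_gt0P.
case: d G_regular => [|[|d]] reg.
(* In-degree 0 is impossible: aperiodicity gives a path of positive length, whose first edge enters
   some vertex. *)
- have [K K0 /(_ K (leqnn _))[[|e p] pK vp]] := G_aperiodic v v.
    by rewrite -pK in K0.
  by have /card0_eq/(_ e) := reg (rng e); rewrite !inE eqxx.
- exact: in_degree_one.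
have d1 : (1 < d.+2)%N by [].
have [K paths] := uniform_length G_aperiodic.
exists (ell2 R), (generic_iso R d1 K), (colouring reg); split.
- exists (bvec R 0%N); apply/eqP => b0; have := nsq_bvec R 0.
  by rewrite b0 nsq0 => /esym/eqP; rewrite oner_eq0.
- exact: ciso_cuntz (spread_vector1 R d1 K).
- exact: wot_algebra_full.
- exact: colouring_strong.
exact: free_semigroupoid_algebra_full.
Qed.
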